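(* Let $\varphi:\mathbb D\to\mathbb D$ be holomorphic of the form $\varphi(z)=\lambda z^p\psi(z)$ with $p\ge2$ an integer, $\lambda\in\mathbb C\setminus\{0\}$, $\psi$ holomorphic on $\mathbb D$ with $\psi(0)=1$ and $\psi$ not vanishing on $\mathbb D$. Assume that there exists $n\ge1$ such that $\|\varphi^{[n]}\|_\infty<1$. Then the composition operator $C_\varphi:f\mapsto f\circ\varphi$ on $H^2(\mathbb D)$ does not have a minimal commutant.
   Context: $\mathbb D$ is the open unit disc, $H^2(\mathbb D)$ the Hardy space, $\varphi^{[n]}=\varphi\circ\cdots\circ\varphi$ ($n$ times), and $\|\cdot\|_\infty$ is the supremum norm on $\mathbb D$. For a bounded operator $A$ on a Hilbert space $H$, $\{A\}'=\{T\in\mathcal B(H):TA=AT\}$, $\mathrm{alg}(A)=\{p(A):p\text{ a polynomial}\}$, and $A$ has a minimal commutant if $\overline{\mathrm{alg}(A)}^{\sigma}=\{A\}'$, where $\sigma$ denotes the weak operator topology. *)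

(* Defs.v *)
From HB Require Import structures.
From mathcomp Require Import all_boot all_order all_algebra.
From mathcomp Require Import complex.
From mathcomp Require Import all_classical all_reals all_analysis.
From mathcomp Require Import ring lra.
Set Implicit Arguments.
Unset Strict Implicit.
Unset Printing Implicit Defensive.
Import Order.TTheory GRing.Theory Num.Theory.
Import numFieldNormedType.Exports.
Import ComplexField.Normc.
Local Open Scope classical_set_scope.
Local Open Scope ring_scope.
Local Open Scope complex_scope.

(* The usual topology and norm of the complex numbers, as a normed space over
   themselves: [derivable f z 1] is then complex differentiability at z. *)
HB.instance Definition _ (R : realType) := NormedModule.copy R[i] (R[i])^o.

Section Disc.
Variable R : realType.
Local Notation C := R[i].
Implicit Types f phi : C -> C.

Definition disc : set C := [set z | `|z| < 1].

Definition holomorphic_on_disc f : Prop :=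
  forall z, disc z -> derivable f z 1.

(* A true supremum only when f is bounded on the disc ([sup] is 0 otherwise). *)
Definition supnorm f : R := sup [set normc (f z) | z in disc].

End Disc.

Section Operators.
Variables (R : realType) (V : lmodType R[i]) (ip : V -> V -> R[i]).

Definition ip_norm (v : V) : R := Num.sqrt (complex.Re (ip v v)).

Record bounded_operator := BoundedOperator {
  bop_linear :> {linear V -> V};
  bop_bounded : exists M : R, forall v, ip_norm (bop_linear v) <= M * ip_norm v
}.

HB.instance Definition _ := gen_eqMixin bounded_operator.
HB.instance Definition _ := gen_choiceMixin bounded_operator.

(* The initial topology for the map from operators to V * V -> C, with pointwise
   convergence: the coarsest making T |-> <T u, v> continuous for all
   u and v. *)
Definition weak_operator_topology :=
  initial_topology (fun (T : bounded_operator) =>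
    (fun uv => ip (T uv.1) uv.2) : {ptws V * V -> R[i]}).

HB.instance Definition _ := Topological.on weak_operator_topology.

Definition commutant (A : bounded_operator) : set bounded_operator :=
  [set T | forall v, T (A v) = A (T v)].

Definition alg (A : bounded_operator) : set bounded_operator :=
  [set T | exists q : {poly R[i]},
    forall v, T v = \sum_(k < size q) q`_k *: iter k A v].

Definition has_minimal_commutant (A : bounded_operator) : Prop :=
  closure (alg A : set weak_operator_topology) = commutant A.

End Operators.

Section Hardy.
Variable R : realType.
Local Notation C := R[i].

Definition square_summable (a : nat -> C) : Prop :=
  cvgn (series (fun n => normc (a n) ^+ 2)).

Definition is_taylor (f : C -> C) (a : nat -> C) : Prop :=
  forall z, disc z -> series (fun n => a n * z ^+ n) @ \oo --> f z.

(* A function on the disc is represented by its extension by 0 to the whole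
   plane, so that two elements of [H2] are equal iff they agree on the disc. *)
Definition hardy_set : set (C -> C) :=
  [set f | (exists a, square_summable a /\ is_taylor f a) /\
           (forall z, ~ disc z -> f z = 0)].

Definition hardy_pred : {pred C -> C} := mem hardy_set.

Lemma square_summable_lin (c : C) (a b : nat -> C) :
  square_summable a -> square_summable b ->
  square_summable (fun n => c * a n + b n).
Proof.
move=> sa sb.
pose u : nat -> R := (2 * normc c ^+ 2) *: (fun n => normc (a n) ^+ 2) +
  2 *: (fun n => normc (b n) ^+ 2).
have n0 (z : C) : 0 <= normc z by case: z => x y; exact: sqrtr_ge0.
apply: (@series_le_cvg _ _ u) => [n|n|n|].
- exact: exprn_ge0.
- by rewrite addr_ge0 // mulr_ge0 ?mulr_ge0 ?exprn_ge0.
- have : normc (c * a n + b n) <= normc c * normc (a n) + normc (b n).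
    have := lec_normD (c * a n) (b n).
    by rewrite normcM /= => /andP[].
  rewrite -[u n]/(2 * normc c ^+ 2 * normc (a n) ^+ 2 +
                  2 * normc (b n) ^+ 2).
  have := n0 (c * a n + b n); have := n0 (a n); have := n0 (b n).
  move: (normc _) (normc (a n)) (normc (b n)) (normc c) => t x y k.
  by move=> *; have := sqr_ge0 (k * x - y); nra.
- by apply: is_cvg_seriesD; exact: is_cvg_seriesZ.
Qed.

Lemma hardy_submod_closed : submod_closed hardy_pred.
Proof.
split=> [|c f g]; rewrite !inE => /=.
- split=> // ; exists (fun=> 0); split=> [|z _].
    rewrite /square_summable (_ : series _ = fun=> 0); first exact: is_cvg_cst.
    by apply/funext => n; apply: big1 => i _; rewrite normc0 expr0n.
  rewrite (_ : series _ = fun=> 0); first exact: cvg_cst.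
  by apply/funext => n; rewrite /series /= big1 // => i _; rewrite mul0r.
- move=> [[a [sa fa]] f0] [[b [sb gb]] g0]; split; last first.
    by move=> z dz; rewrite !fctE f0 // g0 // scaler0 addr0.
  exists (fun n => c * a n + b n); split; first exact: square_summable_lin.
  move=> z dz; rewrite (_ : series _ = fun n =>
    c * series (fun n => a n * z ^+ n) n + series (fun n => b n * z ^+ n) n).
    by apply: cvgD; [apply: cvgMr; exact: fa|exact: gb].
  apply/funext => n; rewrite /series /= mulr_sumr -big_split /=.
  by apply: eq_bigr => i _; rewrite mulrDl mulrA.
Qed.

HB.instance Definition _ :=
  GRing.isSubmodClosed.Build _ _ hardy_pred hardy_submod_closed.

Record H2 := HardyFun { hardy_fun :> C -> C; hardy_funP : hardy_fun \in hardy_pred }.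

HB.instance Definition _ := [isSub of H2 for hardy_fun].
HB.instance Definition _ := [Choice of H2 by <:].
HB.instance Definition _ := [SubChoice_isSubLmodule of H2 by <:].

Lemma H2_taylor (f : H2) : exists a, square_summable a /\ is_taylor f a.
Proof. by have := hardy_funP f; rewrite inE => -[]. Qed.

(* The coefficients of a power series converging on the disc are unique, so
   the choice made here is the only one possible. *)
Definition taylor_coef (f : H2) : nat -> C := projT1 (cid (H2_taylor f)).

Definition H2_inner (f g : H2) : C :=
  limn (series (fun n => taylor_coef f n * conjc (taylor_coef g n))).

Definition is_composition_operator (phi : C -> C)
    (A : bounded_operator H2_inner) : Prop :=
  forall (f : H2) z, disc z -> A f z = f (phi z).

End Hardy.

(* Main.v *)
Require Import Defs.
From HB Require Import structures.
From mathcomp Require Import all_boot all_order all_algebra.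
From mathcomp Require Import complex.
From mathcomp Require Import all_classical all_reals all_analysis.
From mathcomp Require Import ring lra zify.
Set Implicit Arguments.
Unset Strict Implicit.
Unset Printing Implicit Defensive.
Import Order.TTheory GRing.Theory Num.Theory.
Import numFieldNormedType.Exports.
Import ComplexField.Normc.
Local Open Scope classical_set_scope.
Local Open Scope ring_scope.
Local Open Scope complex_scope.

(** Write [A] for the composition operator by [phi], and [phi_iter k] for the
    [k]-th iterate of [phi] as a power series.  The iterate vanishes at 0 to the
    order exactly [p ^ k].  A polynomial in [A] sends the coordinate function
    [z] to a combination of the iterates, so some finitely supported linear form
    on Taylor coefficients kills these images, for all polynomials at once, and
    takes the value 1 on [z ^+ m], as soon as [m] is not a power of [p]
    ([annihilator]).  It is a matrix coefficient of the operator, hence it kills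
    the image of [z] under every element of the weak closure of the algebra
    generated by [A].  It is thus enough to find a bounded operator that
    commutes with [A] and sends [z] to [z ^+ m] plus terms of higher order.

    Such an operator is [twist], formally
      [f |-> \sum_k coord k f * phi_iter k ^+ m],
    where [coord k f] is the residue at 0 of [f' / phi_iter k] divided by
    [p ^ k].  As [phi] is [p]-to-one near 0, a change of variable in residues
    gives [coord k.+1 (f \o phi) = coord k f] and [coord 0 (f \o phi) = 0], and
    this makes [twist] commute with [A].  The functional [coord k] grows at most
    like [K ^+ (p ^ k)], because [1 / phi_iter k] is controlled in a weighted l1
    norm.  On the other hand one iterate has supremum norm less than 1, and
    Schwarz's lemma improves this to a decay of the iterates like
    [t ^+ (p ^ k)] with [t < 1], uniformly on the disc.  For [m] large the
    series converges to a bounded function and the operator is bounded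
    ([twist_bounded]).

    The analysis rests on three facts.  A complex differentiable function on the
    disc is the sum of a power series ([holomorphic_power_series]): Goursat's
    bisection is carried out on trapezoid sums, which vanish exactly on affine
    functions, and applied to a difference quotient on an annulus; Cauchy's
    formula follows with means over roots of unity in place of integrals.
    Multiplication by a function bounded by 1 contracts the Hardy norm
    ([multiplication_contraction], from a discrete Parseval identity), which
    gives Littlewood's subordination principle ([littlewood]), hence the
    boundedness of [A], and the bound of the Hardy norm by the supremum norm. *)

(** * Formal power series *)

(** A record rather than a bare function type: functions into a ring already
    carry the pointwise product, which must not be confused with the Cauchy
    product below. *)
Record fps (K : Type) := FPS { fcoef :> nat -> K }.
HB.instance Definition _ K := gen_eqMixin (fps K).
HB.instance Definition _ K := gen_choiceMixin (fps K).

Lemma fpsP K (f g : fps K) : f =1 g -> f = g.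
Proof. by case: f g => [f] [g] /= /funext ->. Qed.

Section FpsRing.
Variable K : comNzRingType.
Implicit Types (f g h : fps K) (p q : {poly K}).

Definition fps_zero : fps K := FPS (fun=> 0).
Definition fps_one : fps K := FPS (fun n => (n == 0%N)%:R).
Definition fps_opp f := FPS (fun n => - f n).
Definition fps_add f g := FPS (fun n => f n + g n).
Definition fps_mul f g := FPS (fun n => \sum_(i < n.+1) f i * g (n - i)%N).

Let addA : associative fps_add.
Proof. by move=> f g h; apply: fpsP => n /=; rewrite addrA. Qed.
Let addC : commutative fps_add.
Proof. by move=> f g; apply: fpsP => n /=; rewrite addrC. Qed.
Let add0 : left_id fps_zero fps_add.
Proof. by move=> f; apply: fpsP => n /=; rewrite add0r. Qed.
Let addN : left_inverse fps_zero fps_opp fps_add.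
Proof. by move=> f; apply: fpsP => n /=; rewrite addNr. Qed.

HB.instance Definition _ := GRing.isZmodule.Build (fps K) addA addC add0 addN.

Definition trunc N f : {poly K} := \poly_(i < N) f i.

(** The [n]-th coefficient of a product only sees finitely many coefficients of
    the factors, so the ring axioms and the rules for derivation and
    composition can be imported from polynomials. *)
Lemma fps_mul_trunc f g n N : (n < N)%N ->
  fps_mul f g n = (trunc N f * trunc N g)`_n.
Proof.
move=> nN; rewrite coefM; apply: eq_bigr => i _.
rewrite !coef_poly (leq_ltn_trans (leq_subr _ _) nN).
by rewrite (leq_trans (ltn_ord i) nN).
Qed.

Lemma eq_coefM p p' q q' n :
  (forall i, (i <= n)%N -> p`_i = p'`_i) ->
  (forall i, (i <= n)%N -> q`_i = q'`_i) -> (p * q)`_n = (p' * q')`_n.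
Proof.
move=> pp qq; rewrite !coefM; apply: eq_bigr => i _.
by rewrite pp ?qq ?leq_subr // -ltnS.
Qed.

Lemma coef_trunc N f i : (i < N)%N -> (trunc N f)`_i = f i.
Proof. by rewrite coef_poly => ->. Qed.

Let mulA : associative fps_mul.
Proof.
move=> f g h; apply: fpsP => n.
rewrite !(@fps_mul_trunc _ _ n n.+1) //.
transitivity ((trunc n.+1 f * (trunc n.+1 g * trunc n.+1 h))`_n).
  apply: eq_coefM => // i le_in.
  by rewrite coef_trunc // (@fps_mul_trunc _ _ i n.+1).
rewrite mulrA; apply: eq_coefM => // i le_in.
by rewrite coef_trunc // (@fps_mul_trunc _ _ i n.+1).
Qed.
Let mulC : commutative fps_mul.
Proof.
by move=> f g; apply: fpsP => n; rewrite !(@fps_mul_trunc _ _ n n.+1) // mulrC.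
Qed.
Let mul1 : left_id fps_one fps_mul.
Proof.
move=> f; apply: fpsP => n /=.
rewrite big_ord_recl /= mul1r subn0 big1 ?addr0 // => i _.
by rewrite mul0r.
Qed.
Let mulD : left_distributive fps_mul fps_add.
Proof.
move=> f g h; apply: fpsP => n /=; rewrite -big_split /=.
by apply: eq_bigr => i _; rewrite mulrDl.
Qed.
Let one_neq0 : fps_one != fps_zero.
Proof.
by apply/eqP => /(congr1 (fun f : fps K => f 0%N)) /eqP; rewrite /= oner_eq0.
Qed.

HB.instance Definition _ :=
  GRing.Zmodule_isComNzRing.Build (fps K) mulA mulC mul1 mulD one_neq0.

Lemma fps0E n : (0 : fps K) n = 0. Proof. by []. Qed.
Lemma fps1E n : (1 : fps K) n = (n == 0%N)%:R. Proof. by []. Qed.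
Lemma fpsDE f g n : (f + g) n = f n + g n. Proof. by []. Qed.
Lemma fpsBE f g n : (f - g) n = f n - g n. Proof. by []. Qed.
Lemma fpsME f g n : (f * g) n = \sum_(i < n.+1) f i * g (n - i)%N.
Proof. by []. Qed.
Lemma fpsM_trunc f g n N : (n < N)%N -> (f * g) n = (trunc N f * trunc N g)`_n.
Proof. exact: fps_mul_trunc. Qed.
Lemma fps_sumE I r (P : pred I) (F : I -> fps K) n :
  (\sum_(i <- r | P i) F i) n = \sum_(i <- r | P i) F i n.
Proof. by elim/big_rec2: _ => //= i x y _ <-. Qed.
Lemma fpsMnE f k n : (f *+ k) n = f n *+ k.
Proof. by elim: k => // k IH; rewrite !mulrS -IH. Qed.

Lemma eq_fpsM f f' g g' n : (forall i, (i <= n)%N -> f i = f' i) ->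
  (forall i, (i <= n)%N -> g i = g' i) -> (f * g) n = (f' * g') n.
Proof.
move=> ff gg; rewrite !fpsME; apply: eq_bigr => i _.
by rewrite ff ?gg ?leq_subr // -ltnS.
Qed.

Definition fpoly p : fps K := FPS (fun n => p`_n).

Lemma fpoly_is_zmod_morphism : zmod_morphism fpoly.
Proof. by move=> p q; apply: fpsP => n /=; rewrite coefB. Qed.
Lemma fpoly_is_monoid_morphism : monoid_morphism fpoly.
Proof.
split=> [|p q]; apply: fpsP => n; first by rewrite /= coef1.
by rewrite fpsME /= coefM.
Qed.
HB.instance Definition _ :=
  GRing.isZmodMorphism.Build {poly K} (fps K) fpoly fpoly_is_zmod_morphism.
HB.instance Definition _ :=
  GRing.isMonoidMorphism.Build {poly K} (fps K) fpoly fpoly_is_monoid_morphism.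

Definition fC (c : K) : fps K := fpoly c%:P.
HB.instance Definition _ := GRing.RMorphism.copy fC (fpoly \o polyC).

Lemma fCME c f n : (fC c * f) n = c * f n.
Proof.
rewrite fpsME big_ord_recl /= coefC subn0 big1 ?addr0 // => i _.
by rewrite coefC mul0r.
Qed.

Definition fX : fps K := fpoly 'X.

Lemma fXnE N : fX ^+ N = fpoly 'X^N.
Proof. by rewrite rmorphXn. Qed.

Lemma fXnME N f n : (fX ^+ N * f) n = if (n < N)%N then 0 else f (n - N)%N.
Proof.
rewrite fXnE (@fpsM_trunc _ _ _ n.+1) //.
transitivity (('X^N * trunc n.+1 f)`_n).
  by apply: eq_coefM => // i le_in; rewrite coef_trunc.
rewrite coefXnM; case: ifP => // /negbT; rewrite -leqNgt => Nn.
by rewrite coef_trunc // ltnS leq_subr.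
Qed.

(** Order of vanishing at 0: [vanish N f] says that [f] is divisible by the
    [N]-th power of the variable. *)
Definition vanish N f := forall n, (n < N)%N -> f n = 0.
Definition fdrop N f : fps K := FPS (fun n => f (n + N)%N).

Lemma vanishP N f : vanish N f <-> exists g, f = fX ^+ N * g.
Proof.
split=> [f0|[g ->] n nN]; last by rewrite fXnME nN.
exists (fdrop N f); apply: fpsP => n; rewrite fXnME.
case: ltnP => [|Nn]; first exact: f0.
by rewrite /= subnK.
Qed.

Lemma vanishM N M f g : vanish N f -> vanish M g -> vanish (N + M) (f * g).
Proof.
move=> /vanishP[f' ->] /vanishP[g' ->]; apply/vanishP; exists (f' * g').
by rewrite exprD mulrACA.
Qed.

Lemma vanishMl N f g : vanish N f -> vanish N (f * g).
Proof. by move=> f0; rewrite -[N]addn0; apply: vanishM. Qed.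

Lemma vanishX N f n : vanish N f -> vanish (N * n) (f ^+ n).
Proof.
move=> f0; elim: n => [|n IH]; first by rewrite muln0.
by rewrite exprS mulnS; apply: vanishM.
Qed.

Lemma vanishXS f n : f 0%N = 0 -> vanish n (f ^+ n).
Proof. by move=> f0; rewrite -[n in vanish n _]mul1n; apply: vanishX => -[]. Qed.

Lemma fpsM_low N M f g : vanish N f -> vanish M g ->
  (f * g) (N + M)%N = f N * g M.
Proof.
move=> /vanishP[f' ->] /vanishP[g' ->].
have -> : fX ^+ N * f' * (fX ^+ M * g') = fX ^+ (N + M) * (f' * g').
  by rewrite exprD mulrACA.
rewrite !fXnME !ltnn !subnn fpsME big_ord_recl big_ord0 addr0 /=.
by rewrite subnn.
Qed.

(** ** Composition *)

Section Comp.
Variable g : fps K.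

Definition fev p := (map_poly fC p).[g].
HB.instance Definition _ := GRing.RMorphism.copy fev
  (horner_eval g \o map_poly fC).

Lemma fev_poly N (c : nat -> K) :
  fev (\poly_(i < N) c i) = \sum_(i < N) fC (c i) * g ^+ i.
Proof.
rewrite poly_def rmorph_sum /=; apply: eq_bigr => i _.
by rewrite /fev map_polyZ /= map_polyXn hornerZ hornerXn.
Qed.

(** [fcomp g f] is [f] composed with [g].  When [g] has no constant term, the
    powers of index above [n] do not reach the [n]-th coefficient, so a finite
    sum is enough. *)
Definition fcomp f : fps K :=
  FPS (fun n => \sum_(j < n.+1) f j * (g ^+ j) n).

Hypothesis g0 : g 0%N = 0.

Lemma fcompE N f n : (n < N)%N ->
  fcomp f n = \sum_(j < N) f j * (g ^+ j) n.
Proof.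
move=> nN; rewrite /= (big_ord_widen N (fun j => f j * (g ^+ j) n)) //.
rewrite big_mkcond /=; apply: eq_bigr => j _.
case: ifP => // /negbT; rewrite -leqNgt => nj.
by rewrite vanishXS ?mulr0.
Qed.

Lemma fcomp_fev N f n : (n < N)%N -> fcomp f n = fev (trunc N f) n.
Proof.
move=> nN; rewrite (fcompE _ nN) fev_poly fps_sumE.
by apply: eq_bigr => j _; rewrite fCME.
Qed.

(** Truncations of [f] and [h] at [N] multiply to a polynomial that differs
    from the truncation of [f * h] by a multiple of the [N]-th power of the
    variable; evaluated at [g] that multiple vanishes to order [N]. *)
Lemma fcompM f h : fcomp (f * h) = fcomp f * fcomp h.
Proof.
apply: fpsP => n; set N := n.+1.
transitivity ((fev (trunc N f) * fev (trunc N h)) n); last first.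
  apply: eq_fpsM => i le_in; by rewrite (@fcomp_fev N).
rewrite (@fcomp_fev N) // -rmorphM /=.
set P := trunc N f * trunc N h.
have -> : trunc N (f * h) = take_poly N P.
  apply/polyP => i; rewrite coef_take_poly coef_poly; case: ifP => // iN.
  exact: fpsM_trunc.
rewrite -[in RHS](poly_take_drop N P) rmorphD rmorphM rmorphXn fpsDE.
have evX : fev 'X = g by rewrite /fev map_polyX hornerX.
rewrite [X in X ^+ N]evX mulrC (@vanishMl N) ?addr0 //; exact: vanishXS.
Qed.

Lemma fcompD f h : fcomp (f + h) = fcomp f + fcomp h.
Proof.
apply: fpsP => n /=; rewrite -big_split /=.
by apply: eq_bigr => j _; rewrite mulrDl.
Qed.

Lemma fcompN f : fcomp (- f) = - fcomp f.
Proof.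
apply: fpsP => n /=; rewrite -sumrN.
by apply: eq_bigr => j _; rewrite mulNr.
Qed.

Lemma fcompC c : fcomp (fC c) = fC c.
Proof.
apply: fpsP => n; rewrite /= big_ord_recl expr0 !coefC /=.
rewrite big1 ?addr0 => [|i _]; last by rewrite coefC mul0r.
by case: eqP; rewrite ?mulr1 ?mulr0.
Qed.

Lemma fcomp1 : fcomp 1 = 1. Proof. by have := fcompC 1; rewrite rmorph1. Qed.

Lemma fcompXn f n : fcomp (f ^+ n) = fcomp f ^+ n.
Proof. by elim: n => [|n IH]; rewrite ?fcomp1 // !exprS fcompM IH. Qed.

Lemma fcompX : fcomp fX = g.
Proof.
apply: fpsP => n; rewrite (@fcompE n.+2) // 2!big_ord_recl /=.
rewrite !coefX /= expr1 mul0r mul1r add0r big1 ?addr0 // => i _.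
by rewrite coefX mul0r.
Qed.

Lemma fcomp_vanish N f : vanish N f -> fcomp f = g ^+ N * fcomp (fdrop N f).
Proof.
move=> /vanishP[h ->]; rewrite fcompM fcompXn fcompX.
have -> // : fdrop N (fX ^+ N * h) = h.
apply: fpsP => n; rewrite -[LHS]/((fX ^+ N * h) (n + N)%N) fXnME.
by rewrite ltnNge leq_addl /= addnK.
Qed.

(** The recursion behind Littlewood's subordination argument. *)
Lemma fcomp_shift f : fcomp f = fC (f 0%N) + g * fcomp (fdrop 1 f).
Proof.
rewrite -{1}(subrK (fC (f 0%N)) f) fcompD fcompC addrC.
congr (_ + _); rewrite (@fcomp_vanish 1) ?expr1.
  congr (_ * fcomp _); apply: fpsP => n.
  by rewrite /= addn1 coefC subr0.
by case=> //= _; rewrite coefC subrr.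
Qed.

End Comp.

(** ** Derivative *)

Definition fD f : fps K := FPS (fun n => f n.+1 *+ n.+1).

Lemma fDM f g : fD (f * g) = fD f * g + f * fD g.
Proof.
apply: fpsP => n; set N := n.+2.
transitivity (((trunc N f * trunc N g)^`())`_n).
  by rewrite coef_deriv /= -(@fpsM_trunc f g n.+1).
rewrite derivM coefD fpsDE; congr (_ + _);
  rewrite (@fpsM_trunc _ _ n n.+1) //; apply: eq_coefM => i le_in;
  by rewrite ?coef_deriv !coef_trunc ?ltnS ?(leq_trans le_in) //= ltnW.
Qed.

Lemma fDD f g : fD (f + g) = fD f + fD g.
Proof. by apply: fpsP => n /=; rewrite mulrnDl. Qed.

Lemma fD_C c : fD (fC c) = 0.
Proof. by apply: fpsP => n /=; rewrite coefC mul0rn. Qed.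

Lemma fDCM c f : fD (fC c * f) = fC c * fD f.
Proof. by rewrite fDM fD_C mul0r add0r. Qed.

Lemma fDXn f n : fD (f ^+ n.+1) = f ^+ n * fD f *+ n.+1.
Proof.
elim: n => [|n IH]; first by rewrite mul1r.
by rewrite exprS fDM IH mulrnAr mulrA -exprS mulrC [in RHS]mulrS.
Qed.

Lemma fD_fcomp g f : g 0%N = 0 -> fD (fcomp g f) = fcomp g (fD f) * fD g.
Proof.
move=> g0; apply: fpsP => n.
transitivity ((fev g (trunc n.+1 (fD f)) * fD g) n); last first.
  by apply: eq_fpsM => // i le_in; rewrite (@fcomp_fev g _ n.+1).
rewrite fev_poly mulr_suml fps_sumE.
rewrite -[LHS]/(fcomp g f n.+1 *+ n.+1) (@fcompE g _ n.+2) //.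
rewrite big_ord_recl expr0 mulr0 add0r -sumrMnl; apply: eq_bigr => j _.
rewrite -mulrA fCME -mulrnAr lift0.
by rewrite -[_ *+ n.+1]/(fD (g ^+ j.+1) n) fDXn fpsMnE mulrnAr mulrnAl.
Qed.

End FpsRing.

Arguments fX {K}.

(** * Formal commutant of a composition operator *)

Section FormalCommutant.
Variable K : numFieldType.
Variables (phi v : fps K) (p : nat).
Hypothesis p_ge2 : (2 <= p)%N.
Hypothesis phi_vanish : vanish p phi.
Hypothesis phi_v : phi * v = fX ^+ p.

Let p_gt0 : (0 < p)%N. Proof. exact: ltnW. Qed.
Let phi0 : phi 0%N = 0. Proof. exact: phi_vanish. Qed.

Let fD_phi_v : fD phi * v = fX ^+ p.-1 *+ p - phi * fD v.
Proof.
have := congr1 (@fD K) phi_v; rewrite fDM => /(canRL (addrK _)) ->.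
have -> : fX ^+ p = fX ^+ p.-1.+1 :> fps K by rewrite prednK.
rewrite fDXn prednK //; congr (_ *+ _ - _).
have -> : fD fX = 1 :> fps K.
  by apply: fpsP => -[|n]; rewrite /= coefX //= mul0rn.
by rewrite mulr1.
Qed.

(** In residues: the form [fD phi / phi ^+ i] has residue [p] for [i = 1]
    (logarithmic derivative of a zero of order [p]) and residue 0 for [i > 1],
    because it is then exact.  The series [v] is [fX ^+ p / phi], so that
    [v ^+ i] stands for [phi ^- i] up to the shift of the coefficients by
    [p * i]. *)
Lemma residue_pole i : (0 < i)%N ->
  (fD phi * v ^+ i) (p * i).-1 = if i == 1%N then p%:R else 0.
Proof.
case: i => // -[|i] _.
  rewrite expr1 fD_phi_v muln1 fpsBE fpsMnE -[fX ^+ _]mulr1 fXnME ltnn subnn.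
  rewrite (_ : (phi * fD v) p.-1 = 0) ?subr0 //.
  by apply: (vanishMl (fD v) phi_vanish); rewrite prednK.
rewrite [v ^+ _]exprS mulrA fD_phi_v mulrBl fpsBE.
have -> : phi * fD v * v ^+ i.+1 = fX ^+ p * (v ^+ i * fD v).
  by rewrite -phi_v exprS; ring.
have p1 : ((p * i.+2).-1 - p.-1 = p * i.+1)%N by nia.
have p2 : ((p * i.+2).-1 - p = (p * i.+1).-1)%N by nia.
rewrite mulrnAl fpsMnE !fXnME p1 p2.
have -> : ((p * i.+2).-1 < p.-1)%N = false by apply/negbTE; rewrite -leqNgt; nia.
have -> : ((p * i.+2).-1 < p)%N = false by apply/negbTE; rewrite -leqNgt; nia.
apply/eqP; rewrite subr_eq0; apply/eqP.
apply: (@mulfI _ i.+1%:R); first by rewrite pnatr_eq0.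
rewrite !mulr_natl -[in RHS]fpsMnE -fDXn -[fD _ _]/((v ^+ i.+1) _ *+ _).
rewrite prednK ?muln_gt0 ?p_gt0 // -mulrnA mulnC.
by [].
Qed.

(** Change of variable in a residue: pulling back along [phi], which is
    [p]-to-one near 0, multiplies residues by [p].  The terms of [H] of index
    at least [N] pull back to something without a pole, and each of the others
    is an instance of [residue_pole]. *)
Lemma residue_fcomp H N : (0 < N)%N ->
  (fcomp phi H * fD phi * v ^+ N) (p * N).-1 = p%:R * H N.-1.
Proof.
move=> N0.
have HE : H = \sum_(j < N) fC (H j) * fX ^+ j + fX ^+ N * fdrop N H.
  apply: fpsP => n; rewrite fpsDE fXnME fps_sumE.
  under eq_bigr do rewrite fCME -[fX ^+ _]mulr1 fXnME.
  case: ltnP => [nN|Nn].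
    rewrite addr0 (bigD1 (Ordinal nN)) //= ltnn subnn mulr1 big1 ?addr0 //.
    move=> j /eqP jn; case: ltnP => [|jn']; first by rewrite mulr0.
    rewrite ?fps1E; case: eqP => [jn2|]; last by rewrite mulr0.
    by case: jn; apply: val_inj => /=; lia.
  rewrite big1 ?add0r => [|j _]; last first.
    rewrite ltnNge (leq_trans (ltnW (ltn_ord j)) Nn) /= ?fps1E.
    have -> : (n - j == 0)%N = false by apply/eqP; have := ltn_ord j; lia.
    by rewrite mulr0.
  by rewrite /= subnK.
rewrite [in LHS]HE fcompD // fcompM // fcompXn // fcompX //.
have -> : fcomp phi (\sum_(j < N) fC (H j) * fX ^+ j) =
          \sum_(j < N) fC (H j) * phi ^+ j.
  elim/big_rec2: _ => [|j x y _ <-]; first by have := fcompC phi 0; rewrite rmorph0.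
  by rewrite fcompD (fcompM phi0) (fcompC phi) (fcompXn phi0) (fcompX phi0).
rewrite mulrDl mulrDl fpsDE.
rewrite [X in _ + X](_ : _ = 0) ?addr0; last first.
  have -> : phi ^+ N * fcomp phi (fdrop N H) * fD phi * v ^+ N =
    fX ^+ (p * N) * (fcomp phi (fdrop N H) * fD phi).
    by rewrite exprM -phi_v exprMn; ring.
  by rewrite fXnME prednK ?leqnn // muln_gt0 p_gt0.
have termE (j : 'I_N) : (fC (H j) * phi ^+ j * fD phi * v ^+ N) (p * N).-1 =
    H j * if (N - j == 1)%N then p%:R else 0.
  have jN := ltn_ord j.
  have -> : fC (H j) * phi ^+ j * fD phi * v ^+ N =
     fC (H j) * (fX ^+ (p * j) * (fD phi * v ^+ (N - j))).
    have -> : v ^+ N = v ^+ j * v ^+ (N - j) by rewrite -exprD subnKC // ltnW.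
    by rewrite exprM -phi_v exprMn; ring.
  rewrite fCME fXnME.
  have -> : ((p * N).-1 < p * j)%N = false by apply/negbTE; rewrite -leqNgt; nia.
  have -> : ((p * N).-1 - p * j = (p * (N - j)).-1)%N by nia.
  by rewrite residue_pole // subn_gt0.
rewrite !mulr_suml fps_sumE; under eq_bigr do rewrite termE.
have N1 : (N.-1 < N)%N by rewrite prednK.
rewrite (bigD1 (Ordinal N1)) //= big1 ?addr0 => [|j /eqP jN]; last first.
  case: eqP; rewrite ?mulr0 // => jN1.
  by case: jN; apply: val_inj => /=; lia.
have -> : (N - N.-1 == 1)%N by apply/eqP; lia.
exact: mulrC.
Qed.

(** ** Functionals *)

(** [cofactor k] is [fX ^+ (p ^ k) / phi_iter k], see [phi_iter_cofactor]; the
    recursion only composes with [phi] on the right, which keeps both the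
    algebra and the estimates simple. *)
Fixpoint cofactor k : fps K :=
  if k is k'.+1 then v ^+ (p ^ k') * fcomp phi (cofactor k') else 1.

Lemma cofactorS k :
  cofactor k.+1 = v ^+ (p ^ k) * fcomp phi (cofactor k).
Proof. by []. Qed.

Definition phi_iter k : fps K := iter k (fcomp phi) fX.

Lemma phi_iterS k : phi_iter k.+1 = fcomp phi (phi_iter k).
Proof. by []. Qed.

Lemma phi_iter_cofactor k : phi_iter k * cofactor k = fX ^+ (p ^ k).
Proof.
elim: k => [|k IH]; first exact: mulr1.
rewrite phi_iterS cofactorS mulrCA -fcompM // IH fcompXn // fcompX // mulrC.
by rewrite -exprMn phi_v -exprM expnS.
Qed.

(** The residue of [fD f / phi_iter k], divided by [p ^ k].  When [phi] is the
    monomial [fX ^+ p] this is the coefficient of index [p ^ k]; in general it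
    is the coefficient of index [p ^ k], up to a scalar, in the Boettcher
    coordinate. *)
Definition coord k f : K := (p ^ k)%:R^-1 * (fD f * cofactor k) (p ^ k).-1.

Lemma coord0 f : coord 0 f = f 1%N.
Proof.
rewrite /coord expn0 invr1 mul1r (_ : cofactor 0 = 1) // mulr1.
by rewrite /= mulr1n.
Qed.

Lemma coord_fcomp0 f : coord 0 (fcomp phi f) = 0.
Proof.
rewrite coord0 (@fcompE _ _ phi0 2) // 2!big_ord_recl big_ord0 /= ?expr1 ?fps1E /=.
by rewrite phi_vanish // !mulr0 !addr0.
Qed.

(** Composition with [phi] shifts the functionals [coord k]: this is
    [residue_fcomp] with [N = p ^ k], after the chain rule. *)
Lemma coord_fcompS k f : coord k.+1 (fcomp phi f) = coord k f.
Proof.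
have pk : (0 < p ^ k)%N by rewrite expn_gt0 p_gt0.
rewrite /coord fD_fcomp // cofactorS.
have -> : fcomp phi (fD f) * fD phi * (v ^+ (p ^ k) * fcomp phi (cofactor k)) =
  fcomp phi (fD f * cofactor k) * fD phi * v ^+ (p ^ k).
  by rewrite fcompM //; ring.
rewrite expnS residue_fcomp // natrM invfM mulrACA mulVf ?mul1r //.
by rewrite pnatr_eq0 -lt0n.
Qed.

Lemma coordD k f g : coord k (f + g) = coord k f + coord k g.
Proof. by rewrite /coord fDD mulrDl fpsDE mulrDr. Qed.

Lemma coordZ k c f : coord k (fC c * f) = c * coord k f.
Proof. by rewrite /coord fDCM -mulrA fCME mulrCA. Qed.

Lemma phi_iter_vanish k : vanish (p ^ k) (phi_iter k).
Proof.
elim: k => [|k IH]; first by case=> // _; rewrite /= coefX.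
rewrite phi_iterS (fcomp_vanish phi0 IH) expnS.
by apply: vanishMl; apply: vanishX.
Qed.

Lemma phi_iter_lead k : phi_iter k (p ^ k)%N != 0.
Proof.
have := congr1 (fun f : fps K => f (p ^ k + 0)%N) (phi_iter_cofactor k).
rewrite fpsM_low //; last exact: phi_iter_vanish.
rewrite -[fX ^+ _]mulr1 fXnME addn0 ltnn subnn => /eqP.
by apply: contraTneq => ->; rewrite mul0r eq_sym oner_eq0.
Qed.

(** ** A linear form killing all iterates *)

Section Annihilator.
Variable m : nat.
Hypothesis m_pow : forall k, (p ^ k)%N != m.

(** A polynomial in the composition operator sends the variable to a
    combination of the [phi_iter k], whose orders at 0 are the powers of
    [p].  If [m] is not such a power, a linear form supported on [m] and on the
    powers of [p] can be adjusted, from the largest exponent down, to kill all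
    the [phi_iter k] while keeping the value 1 at [m]. *)
Lemma annihilator : exists g : nat -> K, g m = 1 /\
  forall k, \sum_(n < m.+1) g n * phi_iter k n = 0.
Proof.
suff [g [gm g0]] : exists g : nat -> K, g m = 1 /\
    forall k, (m - m <= k)%N -> \sum_(n < m.+1) g n * phi_iter k n = 0.
  by exists g; split=> // k; apply: g0; rewrite subnn.
elim: {3}m => [|i [g [gm g0]]].
  exists (fun n => (n == m)%:R); split; first by rewrite eqxx.
  move=> k; rewrite subn0 => mk; apply: big1 => n _.
  rewrite phi_iter_vanish ?mulr0 // (leq_ltn_trans _ (ltn_expl k p_ge2)) //.
  by rewrite (leq_trans _ mk) // -ltnS.
pose k0 := (m - i.+1)%N.
have sumd (F : nat -> K) a : (a < m.+1)%N ->
    \sum_(n < m.+1) (nat_of_ord n == a)%:R * F n = F a.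
  move=> am; rewrite (bigD1 (Ordinal am)) //= eqxx mul1r big1 ?addr0 //.
  move=> n /eqP na; case: eqP => [na'|]; last by rewrite mul0r.
  by case: na; apply: val_inj.
(* Above [m] there is nothing to correct. *)
have [mk0|] := ltnP m (p ^ k0)%N.
  exists g; split=> // k; rewrite leq_eqVlt => /orP[/eqP <-|k0k].
    apply: big1 => n _; rewrite phi_iter_vanish ?mulr0 //.
    by rewrite (leq_ltn_trans _ mk0) // -ltnS.
  by apply: g0; move: k0k; rewrite -/k0; lia.
move=> k0m.
(* The correction at [p ^ k0] is invisible to the later [phi_iter k]. *)
pose c := - (\sum_(n < m.+1) g n * phi_iter k0 n) / phi_iter k0 (p ^ k0)%N.
exists (fun n => g n + c * (n == p ^ k0)%N%:R); split.
  by rewrite eq_sym (negPf (m_pow k0)) mulr0 addr0.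
move=> k k0k.
under eq_bigr do rewrite mulrDl -mulrA.
rewrite big_split -mulr_sumr /= (sumd (phi_iter k)) //.
move: k0k; rewrite -/k0 leq_eqVlt => /orP[/eqP <-|k0k].
  by rewrite /c mulfVK ?phi_iter_lead // subrr.
rewrite g0 ?add0r; last by move: k0k; lia.
by rewrite phi_iter_vanish ?mulr0 // ltn_exp2l.
Qed.

End Annihilator.

(** ** The commuting operator *)

Variable m : nat.
Hypothesis m_gt0 : (0 < m)%N.

(** Formally [twist f] is the sum over all [k] of
    [coord k f * phi_iter k ^+ m].  Composition with [phi] shifts both the
    functionals and the powers by one step, whence the commutation.  The sum is
    locally finite since [phi_iter k] vanishes to order [p ^ k]. *)
Definition twist f : fps K :=
  FPS (fun n => \sum_(k < n.+1) coord k f * (phi_iter k ^+ m) n).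

Lemma phi_iterX_vanish k : vanish (p ^ k * m) (phi_iter k ^+ m).
Proof. exact/vanishX/phi_iter_vanish. Qed.

Lemma twistE N f n : (n < N)%N ->
  twist f n = \sum_(k < N) coord k f * (phi_iter k ^+ m) n.
Proof.
move=> nN; rewrite /= (big_ord_widen N
  (fun k => coord k f * (phi_iter k ^+ m) n)) //.
rewrite big_mkcond /=; apply: eq_bigr => k _.
case: ifP => // /negbT; rewrite -leqNgt => nk.
rewrite phi_iterX_vanish ?mulr0 //.
by rewrite (leq_trans nk) // (leq_trans (ltnW (ltn_expl k p_ge2))) // leq_pmulr.
Qed.

Lemma twistD f g : twist (f + g) = twist f + twist g.
Proof.
apply: fpsP => n; rewrite fpsDE /= -big_split /=.
by apply: eq_bigr => k _; rewrite coordD mulrDl.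
Qed.

Lemma twistZ c f : twist (fC c * f) = fC c * twist f.
Proof.
apply: fpsP => n; rewrite fCME mulr_sumr.
by apply: eq_bigr => k _; rewrite coordZ -mulrA.
Qed.

Lemma twist_fcomp f : twist (fcomp phi f) = fcomp phi (twist f).
Proof.
apply: fpsP => n; rewrite (@twistE n.+2) //.
rewrite big_ord_recl coord_fcomp0 mul0r add0r.
under eq_bigr do rewrite lift0 coord_fcompS phi_iterS -fcompXn //.
rewrite (@fcompE _ _ phi0 n.+1 (twist f)) //.
under [RHS]eq_bigr => j _ do rewrite (@twistE n.+1) // mulr_suml.
rewrite exchange_big /=; apply: eq_bigr => k _.
rewrite mulr_sumr.
by apply: eq_bigr => j _; rewrite mulrA.
Qed.

Lemma twistX n : (n <= m)%N -> twist fX n = (n == m)%:R.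
Proof.
move=> nm; rewrite (@twistE n.+1) // big_ord_recl big1 => [|k _]; last first.
  rewrite phi_iterX_vanish ?mulr0 // (leq_ltn_trans nm) //.
  rewrite -[X in (X < _)%N]mul1n ltn_pmul2r //.
  by rewrite lift0 (leq_ltn_trans _ (ltn_expl _ p_ge2)).
by rewrite addr0 coord0 /= coefX mul1r fXnE /= coefXn.
Qed.

End FormalCommutant.

(** * Complex moduli and convergence *)

Section Modulus.
Variable R : realType.
Local Notation C := R[i].
Implicit Types (x y z : C).

Lemma normc_ge0 x : 0 <= normc x.
Proof. by case: x => a b; exact: sqrtr_ge0. Qed.

Lemma ler_normc_add x y : normc (x + y) <= normc x + normc y.
Proof. exact: le_normcD. Qed.

Lemma normc_opp x : normc (- x) = normc x.
Proof. exact: normcN. Qed.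

Lemma normc_distC x y : normc (x - y) = normc (y - x).
Proof. by rewrite -normc_opp opprB. Qed.

Lemma ler_normc_dist x y z : normc (x - z) <= normc (x - y) + normc (y - z).
Proof. by have := ler_normc_add (x - y) (y - z); rewrite addrA subrK. Qed.

Lemma ler_normc_sub x y : normc (x - y) <= normc x + normc y.
Proof. by have := ler_normc_add x (- y); rewrite normc_opp. Qed.

Lemma normcX x n : normc (x ^+ n) = normc x ^+ n.
Proof. by elim: n => [|n IH]; rewrite ?normc1 // !exprS normcM IH. Qed.

Lemma normc_eq0 x : (normc x == 0) = (x == 0).
Proof. by apply/eqP/eqP => [/eq0_normc //|->]; exact: normc0. Qed.

Lemma normc_gt0 x : (0 < normc x) = (x != 0).
Proof. by rewrite lt_def normc_ge0 andbT normc_eq0. Qed.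

Lemma normc_real (a : R) : normc a%:C = `|a|.
Proof. by rewrite /normc /= expr0n addr0 sqrtr_sqr. Qed.

Lemma normc_i : normc ('i : C) = 1.
Proof. by rewrite /normc /= expr0n expr1n add0r sqrtr1. Qed.

Lemma normcJ (x : C) : normc (conjc x) = normc x.
Proof. by case: x => a b; rewrite /normc /= sqrrN. Qed.

Lemma ler_normc_sum I (r : seq I) (P : pred I) (F : I -> C) :
  normc (\sum_(i <- r | P i) F i) <= \sum_(i <- r | P i) normc (F i).
Proof.
elim/big_rec2: _ => [|i y x _ le_xy]; first by rewrite normc0.
by apply: le_trans (ler_normc_add _ _) _; rewrite lerD2l.
Qed.

Lemma normc_sqr x : (normc x ^+ 2)%:C = x * conjc x.
Proof.
case: x => a b; rewrite /normc /= sqr_sqrtr ?addr_ge0 ?sqr_ge0 //.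
by apply/eqP; rewrite eq_complex /=; apply/andP; split; apply/eqP; ring.
Qed.

Lemma normcE x : `|x| = (normc x)%:C. Proof. by []. Qed.

Lemma discE z : disc z <-> normc z < 1.
Proof. by rewrite /disc /= normcE -(ltcR (normc z) 1). Qed.

Lemma normc_Re (x : C) : `|complex.Re x| <= normc x.
Proof.
case: x => a b; rewrite /= -sqrtr_sqr ler_wsqrtr // lerDl sqr_ge0 //.
Qed.

Lemma normc_Im (x : C) : `|complex.Im x| <= normc x.
Proof.
case: x => a b; rewrite /= -sqrtr_sqr ler_wsqrtr // lerDr sqr_ge0 //.
Qed.

Lemma normc_ReIm (x : C) : normc x <= `|complex.Re x| + `|complex.Im x|.
Proof.
rewrite {1}[x]complexE; apply: le_trans (ler_normc_add _ _) _.
by rewrite normcM normc_i mul1r !normc_real.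
Qed.

(** ** Limits of complex sequences *)

(** Convergence with real rather than complex tolerances. *)
Definition tends (u : nat -> C) (l : C) : Prop :=
  forall e : R, 0 < e ->
    exists N, forall n, (N <= n)%N -> normc (u n - l) < e.

Lemma tendsP u l : tends u l <-> u @ \oo --> l.
Proof.
split=> [ul|/cvgrPdist_lt ul e e0].
  apply/cvgrPdist_lt => e; rewrite ltcE /= => /andP[/eqP Ie Re0].
  have [N HN] := ul _ Re0; exists N => // n /= Nn.
  rewrite normcE -[e](RRe_real (gtr0_real _)).
    by rewrite ltcR normc_distC; exact: HN.
  by rewrite ltcE /= Ie Re0 eqxx.
have e0C : (0 : C) < e%:C by rewrite (ltcR 0 e).
have [N _ HN] := ul _ e0C; exists N => n Nn.
by have := HN n Nn; rewrite /= normcE ltcR normc_distC.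
Qed.

Lemma tends_unique u l l' : tends u l -> tends u l' -> l = l'.
Proof.
move=> ul ul'; apply/eqP; rewrite -subr_eq0 -normc_eq0; apply/eqP.
apply/eqP; rewrite eq_le normc_ge0 andbT leNgt; apply/negP => d0.
have d2 : 0 < normc (l - l') / 2 by rewrite divr_gt0.
have [N1 H1] := ul _ d2; have [N2 H2] := ul' _ d2.
have := H1 (maxn N1 N2) (leq_maxl _ _); have := H2 (maxn N1 N2) (leq_maxr _ _).
have := ler_normc_dist l (u (maxn N1 N2)) l'.
by rewrite [normc (l - u _)]normc_distC; lra.
Qed.

Lemma tends_eq u v l : u =1 v -> tends u l -> tends v l.
Proof. by move=> /funext ->. Qed.

Lemma tendsD u v l k : tends u l -> tends v k ->
  tends (fun n => u n + v n) (l + k).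
Proof.
move=> /(tendsP u l) ul /(tendsP v k) vk; apply/tendsP; apply: cvgD.
  exact: ul.
exact: vk.
Qed.

Lemma tendsM u v l k : tends u l -> tends v k ->
  tends (fun n => u n * v n) (l * k).
Proof.
move=> /(tendsP u l) ul /(tendsP v k) vk; apply/tendsP; apply: cvgM.
  exact: ul.
exact: vk.
Qed.

Lemma tends_le u l x B : tends u l ->
  (exists N, forall n, (N <= n)%N -> normc (u n - x) <= B) -> normc (l - x) <= B.
Proof.
move=> ul [N HN]; apply/ler_addgt0Pr => e e0.
have [M HM] := ul e e0; set n := maxn N M.
have := HN n (leq_maxl _ _); have := HM n (leq_maxr _ _).
have := ler_normc_dist l (u n) x; rewrite [normc (l - u n)]normc_distC.
by move=> ? ? ?; lra.
Qed.

Lemma expr_small (q e : R) : 0 <= q -> q < 1 -> 0 < e ->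
  exists N, forall n, (N <= n)%N -> q ^+ n < e.
Proof.
move=> q0 q1 e0.
have /cvgrPdist_lt /(_ e e0) [N _ HN] : (fun n => q ^+ n) @ \oo --> 0.
  by apply: cvg_expr; rewrite ger0_norm.
exists N => n Nn; have := HN n Nn.
by rewrite /= sub0r normrN ger0_norm // exprn_ge0.
Qed.

Lemma geometric_bound (q : R) N : 0 <= q -> q < 1 ->
  \sum_(n < N) q ^+ n <= (1 - q)^-1.
Proof.
move=> q0 q1; have q1' : 0 < 1 - q by rewrite subr_gt0.
rewrite -[X in _ <= X]mul1r ler_pdivlMr // mulrC.
have -> : (1 - q) * (\sum_(n < N) q ^+ n) = 1 - q ^+ N.
  by rewrite -opprB mulNr -subrX1 opprB.
by rewrite gerBl exprn_ge0.
Qed.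

Lemma nondecreasing_tail (u : nat -> R) B : {homo u : m n / (m <= n)%N >-> m <= n} ->
  (forall n, u n <= B) ->
  forall e, 0 < e -> exists N, forall n, (N <= n)%N -> u n - u N < e.
Proof.
move=> uh uB e e0.
have ub : has_sup (range u).
  by split; [exists (u 0%N), 0%N|exists B => _ [n _ <-]].
have [_ [N _ <-] HN] := sup_adherent e0 ub.
exists N => n Nn; have : u n <= sup (range u).
  by apply: (ub_le_sup ub.2); exists n.
lra.
Qed.

End Modulus.

(** * Convergent power series *)

Section PowerSeries.
Variable R : realType.
Local Notation C := R[i].
Implicit Types (a b : fps C) (f g : C -> C).

Definition psum a z N : C := \sum_(n < N) a n * z ^+ n.

(** [a] is the Taylor series at 0 of [f] on the open unit disc, see
    [evals_taylor]. *)
Definition evals a f := forall z, normc z < 1 -> tends (psum a z) (f z).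

Lemma evals_taylor a f : evals a f <-> is_taylor f a.
Proof.
have sE z : psum a z = series (fun n => a n * z ^+ n).
  by apply/funext => N; rewrite /series /= big_mkord.
by split=> H z /discE z1; have := H z z1; rewrite tendsP sE.
Qed.

(** A truncated weighted l1 norm.  Working with finite sums avoids all
    convergence questions, and submultiplicativity survives truncation. *)
Definition wnorm (r : R) N a : R := \sum_(n < N) normc (a n) * r ^+ n.

Let term_ge0 (r : R) a n : 0 <= r -> 0 <= normc (a n) * r ^+ n.
Proof. by move=> r0; rewrite mulr_ge0 ?normc_ge0 ?exprn_ge0. Qed.

Lemma wnorm_ge0 r N a : 0 <= r -> 0 <= wnorm r N a.
Proof. by move=> r0; apply: sumr_ge0 => n _; exact: term_ge0. Qed.

Lemma wnorm_homo r a : 0 <= r ->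
  {homo (fun N => wnorm r N a) : m n / (m <= n)%N >-> m <= n}.
Proof.
move=> r0; apply: homo_leq => //; first exact: le_trans.
by move=> n; rewrite /wnorm big_ord_recr /= lerDl term_ge0.
Qed.

Lemma wnorm_psum a z N : normc (psum a z N) <= wnorm (normc z) N a.
Proof.
apply: le_trans (ler_normc_sum _ _ _) _.
by apply: ler_sum => n _; rewrite normcM normcX.
Qed.

(* Majorants as real polynomials: products of power series are estimated through
   products of these, evaluated at 1. *)
Let absP r N a : {poly R} := \poly_(i < N) (normc (a i) * r ^+ i).

Let absP_horner r N a : (absP r N a).[1] = wnorm r N a.
Proof.
rewrite horner_poly; apply: eq_bigr => i _.
by rewrite expr1n mulr1.
Qed.

Let absP_ge0 r N a i : 0 <= r -> 0 <= (absP r N a)`_i.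
Proof. by move=> r0; rewrite coef_poly; case: ifP => // _; exact: term_ge0. Qed.

Let absPM_ge0 r N a b i : 0 <= r -> 0 <= (absP r N a * absP r N b)`_i.
Proof.
by move=> r0; rewrite coefM; apply: sumr_ge0 => j _; rewrite mulr_ge0 ?absP_ge0.
Qed.

Let absPM_homo r M N a b i : 0 <= r -> (M <= N)%N ->
  (absP r M a * absP r M b)`_i <= (absP r N a * absP r N b)`_i.
Proof.
move=> r0 MN; rewrite !coefM; apply: ler_sum => j _.
have H c k : (absP r M c)`_k <= (absP r N c)`_k.
  rewrite !coef_poly; case: ifP => [kM|_].
    by rewrite (leq_trans kM MN).
  by case: ifP => // _; exact: term_ge0.
by rewrite ler_pM ?absP_ge0.
Qed.

Let coefM_absP r N a b i : 0 <= r ->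
  normc ((trunc N a * trunc N b)`_i) * r ^+ i <= (absP r N a * absP r N b)`_i.
Proof.
move=> r0; rewrite !coefM.
apply: le_trans (ler_wpM2r (exprn_ge0 _ r0) (ler_normc_sum _ _ _)) _.
rewrite mulr_suml; apply: ler_sum => j _.
have jE : (j + (i - j) = i)%N by rewrite subnKC // -ltnS.
rewrite normcM -[in r ^+ i]jE exprD mulrACA.
have H c k : normc (trunc N c)`_k * r ^+ k = (absP r N c)`_k.
  by rewrite !coef_poly; case: ifP => // _; rewrite normc0 mul0r.
by rewrite !H.
Qed.

Let size_absPM r N a b : (size (absP r N a * absP r N b)%R <= N + N)%N.
Proof.
apply: leq_trans (size_polyMleq _ _) _; rewrite (leq_trans (leq_pred _)) //.
by rewrite leq_add // size_poly.
Qed.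

Let absPM_sum r N a b :
  \sum_(i < N + N) (absP r N a * absP r N b)`_i = wnorm r N a * wnorm r N b.
Proof.
rewrite -!absP_horner -hornerM (@horner_coef_wide _ (N + N)) //.
by apply: eq_bigr => i _; rewrite expr1n mulr1.
Qed.

Lemma wnormM r N a b : 0 <= r ->
  wnorm r N (a * b) <= wnorm r N a * wnorm r N b.
Proof.
move=> r0; rewrite -absPM_sum big_split_ord /=.
rewrite -[leLHS]addr0 lerD //; last by apply: sumr_ge0 => i _; exact: absPM_ge0.
apply: ler_sum => i _; rewrite (@fpsM_trunc _ _ _ _ N) //; exact: coefM_absP.
Qed.

Lemma wnorm1 r N : wnorm r N 1 <= 1.
Proof.
case: N => [|N]; first by rewrite /wnorm big_ord0.
rewrite /wnorm big_ord_recl big1 => [|i _]; last first.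
  by rewrite (_ : (1 : fps C) _ = 0) ?normc0 ?mul0r // fps1E lift0.
by rewrite fps1E eqxx mulr1n normc1 expr0 mulr1 addr0.
Qed.

Lemma wnormX r N a n : 0 <= r -> wnorm r N (a ^+ n) <= wnorm r N a ^+ n.
Proof.
move=> r0; elim: n => [|n IH]; first exact: wnorm1.
rewrite !exprS; apply: le_trans (wnormM _ _ _ r0) _.
by rewrite ler_wpM2l ?wnorm_ge0.
Qed.

Lemma terms_bounded a (s : R) l : 0 < s -> tends (psum a s%:C) l ->
  exists2 A, 0 < A & forall n, normc (a n) * s ^+ n <= A.
Proof.
move=> s0 al; have [N0 HN] := al 1 ltr01.
have w0 := wnorm_ge0 N0 a (ltW s0).
exists (2 + wnorm s N0 a) => [|n]; first lra.
have -> : normc (a n) * s ^+ n = normc (a n * s%:C ^+ n).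
  by rewrite normcM normcX normc_real ger0_norm // ltW.
have [N0n|nN0] := leqP N0 n.
  have -> : a n * s%:C ^+ n = psum a s%:C n.+1 - psum a s%:C n.
    by rewrite /psum big_ord_recr /= addrAC subrr add0r.
  have := ler_normc_dist (psum a s%:C n.+1) l (psum a s%:C n).
  have := HN n N0n; have := HN n.+1 (leq_trans N0n (leqnSn _)).
  by rewrite [normc (l - _)]normc_distC; lra.
rewrite /wnorm (bigD1 (Ordinal nN0)) //= normcM normcX normc_real.
rewrite (ger0_norm (ltW s0)) addrCA lerDl addr_ge0 ?sumr_ge0 // => i _.
exact: term_ge0 (ltW s0).
Qed.

(** Convergence at a point of modulus [s > r] gives geometric decay at [r]. *)
Lemma evals_wnorm_bounded a f r : evals a f -> 0 <= r -> r < 1 ->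
  exists B, forall N, wnorm r N a <= B.
Proof.
move=> af r0 r1; pose s := (r + 1) / 2.
have s0 : 0 < s by rewrite /s; lra.
have s1 : s < 1 by rewrite /s; lra.
have rs : r < s by rewrite /s; lra.
have ns : normc s%:C < 1 by rewrite normc_real ger0_norm // ltW.
have [A A0 An] := terms_bounded s0 (af _ ns).
exists (A * (1 - r / s)^-1) => N.
have q0 : 0 <= r / s by rewrite divr_ge0 // ltW.
have q1 : r / s < 1 by rewrite ltr_pdivrMr // mul1r.
apply: le_trans (ler_wpM2l (ltW A0) (geometric_bound N q0 q1)).
rewrite mulr_sumr; apply: ler_sum => n _.
have -> : normc (a n) * r ^+ n = normc (a n) * s ^+ n * (r / s) ^+ n.
  by rewrite -mulrA -exprMn [s * _]mulrC divfK // gt_eqF.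
by rewrite ler_wpM2r ?exprn_ge0.
Qed.

(** Cauchy product.  The difference between the product of two partial sums and
    the partial sum of the product only involves pairs of indices at least one
    of which is large; the majorants bound it by the increment of the product
    of the partial sums of absolute values. *)
Lemma evalsM a b f g : evals a f -> evals b g ->
  evals (a * b) (fun z => f z * g z).
Proof.
move=> af bg z z1; set r := normc z.
have r0 : 0 <= r := normc_ge0 z.
have [A HA] := evals_wnorm_bounded af r0 z1.
have [B HB] := evals_wnorm_bounded bg r0 z1.
have A0 : 0 <= A := le_trans (wnorm_ge0 0 a r0) (HA 0%N).
have B0 : 0 <= B := le_trans (wnorm_ge0 0 b r0) (HB 0%N).
have err n h : (h + h <= n)%N ->
    normc (psum (a * b) z n - psum a z n * psum b z n) <=
    wnorm r n a * wnorm r n b - wnorm r h a * wnorm r h b.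
  move=> hn; pose PQ := trunc n a * trunc n b.
  have -> : psum a z n * psum b z n = \sum_(i < n + n) PQ`_i * z ^+ i.
    rewrite -horner_coef_wide; last first.
      apply: leq_trans (size_polyMleq _ _) _.
      by rewrite (leq_trans (leq_pred _)) // leq_add // size_poly.
    by rewrite /PQ hornerM /trunc !horner_poly.
  rewrite big_split_ord /=.
  have -> : psum (a * b) z n = \sum_(i < n) PQ`_i * z ^+ i.
    by apply: eq_bigr => i _; rewrite (@fpsM_trunc _ _ _ _ n).
  rewrite opprD addrA subrr sub0r normc_opp.
  apply: le_trans (ler_normc_sum _ _ _) _.
  apply: (@le_trans _ _ (\sum_(i < n) (absP r n a * absP r n b)`_(n + i))).
    by apply: ler_sum => i _; rewrite normcM normcX; exact: coefM_absP.
  rewrite -(absPM_sum r n) big_split_ord /= -addrA addrCA lerDl subr_ge0.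
  rewrite -absPM_sum (big_ord_widen n (fun i => (absP r h a * absP r h b)`_i)) //.
  rewrite big_mkcond /=; apply: ler_sum => i _; case: ifP => _.
    apply: absPM_homo => //; exact: leq_trans (leq_addr _ _) hn.
  exact: absPM_ge0.
have prod0 : tends (fun n => psum (a * b) z n - psum a z n * psum b z n) 0.
  move=> e e0; pose e' := e / (A + B + 1).
  have D0 : 0 < A + B + 1 by lra.
  have e'0 : 0 < e' by rewrite divr_gt0.
  have [N1 H1] := nondecreasing_tail (wnorm_homo a r0) HA e'0.
  have [N2 H2] := nondecreasing_tail (wnorm_homo b r0) HB e'0.
  pose h := maxn N1 N2; exists (h + h)%N => n hn; rewrite subr0.
  apply: le_lt_trans (err n h hn) _.
  have le1 := wnorm_homo a r0 (leq_maxl N1 N2 : (N1 <= h)%N).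
  have le2 := wnorm_homo b r0 (leq_maxr N1 N2 : (N2 <= h)%N).
  have hn' : (h <= n)%N by apply: leq_trans hn; rewrite leq_addr.
  have := H1 n (leq_trans (leq_maxl _ _) hn').
  have := H2 n (leq_trans (leq_maxr _ _) hn').
  have := wnorm_homo a r0 hn'; have := wnorm_homo b r0 hn'.
  have := HA h; have := HB n; move: le1 le2 => /=.
  have := wnorm_ge0 h a r0; have := wnorm_ge0 n b r0.
  have -> : e = e' * (A + B + 1) by rewrite /e' divfK ?gt_eqF.
  move: (wnorm r n a) (wnorm r h a) (wnorm r N1 a) => x1 x2 x3.
  move: (wnorm r n b) (wnorm r h b) (wnorm r N2 b) => y1 y2 y3.
  move=> *; have : (x1 - x2) * y1 <= e' * B by apply: ler_pM; lra.
  have : x2 * (y1 - y2) <= A * e' by apply: ler_pM; lra.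
  nra.
have := tendsD prod0 (tendsM (af z z1) (bg z z1)); rewrite add0r.
by apply: tends_eq => n; rewrite subrK.
Qed.

Lemma evalsD a b f g : evals a f -> evals b g -> evals (a + b) (fun z => f z + g z).
Proof.
move=> af bg z z1; apply: tends_eq (tendsD (af z z1) (bg z z1)) => N.
by rewrite /psum -big_split; apply: eq_bigr => n _; rewrite [RHS]mulrDl.
Qed.

Lemma evals_poly (q : {poly C}) : evals (fpoly q) (fun z => q.[z]).
Proof.
move=> z _ e e0; exists (size q) => n qn.
by rewrite (horner_coef_wide z qn) subrr normc0.
Qed.

Lemma evalsC c : evals (fC c) (fun=> c).
Proof.
move=> z z1; have := evals_poly c%:P z1; rewrite hornerC; exact.
Qed.

Lemma evalsX a f n : evals a f -> evals (a ^+ n) (fun z => f z ^+ n).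
Proof.
move=> af; elim: n => [|n IH].
  move=> z z1; have := evalsC 1 z1; by rewrite rmorph1 expr0.
by move=> z z1; rewrite !exprS; exact: (evalsM af IH z1).
Qed.

End PowerSeries.

(** * Roots of unity and the subordination principle *)

Section RootsOfUnity.
Variable R : realType.
Local Notation C := R[i].

Definition cis (t : R) : C := cos t +i* sin t.

Lemma cis0 : cis 0 = 1.
Proof. by rewrite /cis cos0 sin0. Qed.

Lemma cisD s t : cis (s + t) = cis s * cis t.
Proof.
apply/eqP; rewrite eq_complex /= cosD sinD; apply/andP.
by split; apply/eqP; ring.
Qed.

Lemma cisX t n : cis t ^+ n = cis (t *+ n).
Proof.
by elim: n => [|n IH]; rewrite ?cis0 // exprS IH -cisD mulrS.
Qed.

Lemma normc_cis t : normc (cis t) = 1.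
Proof. by rewrite /normc /= cos2Dsin2 sqrtr1. Qed.

Lemma cis_conj t : cis t * conjc (cis t) = 1.
Proof. by rewrite -normc_sqr normc_cis expr1n. Qed.

Lemma cis_neq1 t : 0 < t -> t < pi *+ 2 -> cis t != 1.
Proof.
move=> t0 t2; apply/eqP => /(congr1 (@complex.Re R)) /=.
have -> : t = t / 2 *+ 2 by rewrite mulr2n; lra.
rewrite cos_mulr2n cos2sin2 => H.
have : 0 < sin (t / 2) by apply: sin_gt0_pi; apply/andP; split; move: t2; rewrite mulr2n; lra.
move: H; rewrite mulr2n => H s0; nra.
Qed.

(** The primitive root of unity [exp(2 i pi / N)]. *)
Definition zeta N : C := cis (pi *+ 2 / N%:R).

Lemma zetaX N k : (0 < N)%N -> zeta N ^+ k = cis (pi *+ 2 * (k%:R / N%:R)).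
Proof.
by move=> N0; rewrite /zeta cisX -mulrnAr [k%:R * _]mulr_natl.
Qed.

Lemma zeta_order N : (0 < N)%N -> zeta N ^+ N = 1.
Proof.
move=> N0; rewrite zetaX // divff ?pnatr_eq0 -?lt0n // mulr1.
by rewrite /cis sin2pi -[pi *+ 2]add0r cosD2pi cos0.
Qed.

Lemma zeta_primitive N k : (0 < k)%N -> (k < N)%N -> zeta N ^+ k != 1.
Proof.
move=> k0 kN; have N0 : (0 < N)%N := leq_ltn_trans (leq0n k) kN.
have pi2 : 0 < pi *+ 2 :> R by rewrite mulrn_wgt0 // pi_gt0.
rewrite zetaX //; apply: cis_neq1.
  by rewrite mulr_gt0 // divr_gt0 // ltr0n.
rewrite -[ltRHS]mulr1 ltr_pM2l // ltr_pdivrMr ?ltr0n //.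
by rewrite mul1r ltr_nat.
Qed.

Lemma normc_zetaX N k : normc (zeta N ^+ k) = 1.
Proof. by rewrite normcX normc_cis expr1n. Qed.

Lemma sum_root_of_unity (x : C) N : x ^+ N = 1 -> x != 1 ->
  \sum_(k < N) x ^+ k = 0.
Proof.
move=> xN x1; apply: (@mulfI _ (x - 1)); first by rewrite subr_eq0.
by rewrite mulr0 -subrX1 xN subrr.
Qed.

(** Discrete Parseval identity, from the orthogonality of the characters of the
    cyclic group of order [N].  It replaces integration over circles. *)
Lemma parseval N (c : nat -> C) : (0 < N)%N ->
  \sum_(k < N) normc (\sum_(n < N) c n * (zeta N ^+ k) ^+ n) ^+ 2 =
  N%:R * \sum_(n < N) normc (c n) ^+ 2.
Proof.
move=> N0; apply: complexI; rewrite rmorphM !rmorph_sum /= rmorph_nat.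
pose w := zeta N; pose w' := conjc w.
have ww' n : w ^+ n * w' ^+ n = 1 by rewrite -exprMn cis_conj expr1n.
have wN : w ^+ N = 1 := zeta_order N0.
have w'N : w' ^+ N = 1 by rewrite -[LHS]mul1r -wN ww'.
have w'_prim n : (0 < n)%N -> (n < N)%N -> w' ^+ n != 1.
  move=> n0 nN; apply: contra (zeta_primitive n0 nN) => /eqP H.
  by rewrite -(ww' n) H mulr1.
transitivity (\sum_(k < N) \sum_(n < N) \sum_(m < N)
    c n * conjc (c m) * (w ^+ n * w' ^+ m) ^+ k).
  apply: eq_bigr => k _; rewrite normc_sqr rmorph_sum mulr_suml.
  apply: eq_bigr => n _; rewrite mulr_sumr; apply: eq_bigr => m _ /=.
  rewrite rmorphM !rmorphXn /= -/w -/w' mulrACA; congr (_ * _).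
  by rewrite exprMn -!exprM [(k * n)%N]mulnC [(k * m)%N]mulnC.
rewrite exchange_big mulr_sumr; apply: eq_bigr => n _.
rewrite exchange_big (bigD1 n) //= [X in _ + X]big1 => [|m mn].
  rewrite ww' addr0; under eq_bigr do rewrite expr1n mulr1.
  by rewrite sumr_const card_ord normc_sqr mulr_natl.
rewrite -mulr_sumr sum_root_of_unity ?mulr0 //.
  by rewrite exprMn -!exprM ![(_ * N)%N]mulnC !exprM wN w'N !expr1n mulr1.
have [nm|] := ltnP n m.
  rewrite -(subnKC (ltnW nm)) exprD mulrA ww' mul1r w'_prim ?subn_gt0 //.
  exact: leq_ltn_trans (leq_subr _ _) (ltn_ord m).
rewrite leq_eqVlt => /orP[/eqP/val_inj mn'|lt_mn].
  by rewrite mn' eqxx in mn.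
rewrite -(subnK (ltnW lt_mn)) exprD -mulrA ww' mulr1 zeta_primitive ?subn_gt0 //.
exact: leq_ltn_trans (leq_subr _ _) (ltn_ord n).
Qed.

End RootsOfUnity.

Section Subordination.
Variable R : realType.
Local Notation C := R[i].
Implicit Types (a g : fps C).

(** Partial sum of the squared Hardy norm. *)
Definition l2 M a : R := \sum_(n < M) normc (a n) ^+ 2.

Lemma l2_ge0 M a : 0 <= l2 M a.
Proof. by apply: sumr_ge0 => n _; rewrite sqr_ge0. Qed.

Lemma l2_homo a : {homo (fun M => l2 M a) : m n / (m <= n)%N >-> m <= n}.
Proof.
apply: homo_leq => //; first exact: le_trans.
by move=> n; rewrite /l2 big_ord_recr /= lerDl sqr_ge0.
Qed.

Lemma l2_coef a n : normc (a n) ^+ 2 <= l2 n.+1 a.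
Proof. by rewrite /l2 big_ord_recr /= lerDr l2_ge0. Qed.

Lemma bernoulli (d : R) n : 0 <= d -> d <= 1 -> 1 - n%:R * d <= (1 - d) ^+ n.
Proof.
move=> d0 d1; elim: n => [|n IH]; first by rewrite mul0r subr0.
rewrite exprS -natr1; apply: (@le_trans _ _ ((1 - d) * (1 - n%:R * d))).
  by have := mulr_ge0 (ler0n R n) (sqr_ge0 d); rewrite expr2; nra.
by rewrite ler_wpM2l // subr_ge0.
Qed.

Variables (phi : fps C) (f : C -> C).
Hypothesis phif : evals phi f.
Hypothesis f_le1 : forall z, normc z < 1 -> normc (f z) <= 1.

(* The identity of [parseval] applied to the product of a Taylor polynomial of
   [phi], nearly bounded by 1 on the circle of radius [r], with the truncation
   of [g] at [M]; the first [M] coefficients of that product are those of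
   [phi * g]. *)
Let contraction_radius r e M g : 0 < r -> r < 1 -> 0 < e ->
  \sum_(n < M) normc ((phi * g) n) ^+ 2 * (r ^+ 2) ^+ n <=
  (1 + e) ^+ 2 * l2 M g.
Proof.
move=> r0 r1 e0.
have rnorm (w : C) : normc w = 1 -> normc (r%:C * w) = r.
  by move=> w1; rewrite normcM w1 mulr1 normc_real ger0_norm // ltW.
have [B HB] := evals_wnorm_bounded phif (ltW r0) r1.
have [d0 Hd0] := nondecreasing_tail (wnorm_homo phi (ltW r0)) HB e0.
pose d := maxn d0 M.
have dM : (M <= d)%N by rewrite leq_maxr.
have psum_le z : normc z = r -> normc (psum phi z d) <= 1 + e.
  move=> zr; have z1 : normc z < 1 by rewrite zr.
  have := ler_normc_dist (psum phi z d) (f z) 0; rewrite !subr0.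
  move=> /le_trans; apply; rewrite addrC lerD ?f_le1 // normc_distC.
  apply: (tends_le (phif z1)); exists d => n dn.
  have [k nE] : exists k, n = (d + k)%N by exists (n - d)%N; rewrite subnKC.
  move: dn; rewrite nE => dn; rewrite /psum big_split_ord /= addrAC subrr add0r.
  apply: le_trans (ler_normc_sum _ _ _) _.
  have := Hd0 _ (leq_trans (leq_maxl d0 M) dn).
  rewrite {1}/wnorm big_split_ord /=.
  have := wnorm_homo phi (ltW r0) (leq_maxl d0 M : (d0 <= d)%N).
  rewrite -/(wnorm r d phi) /= => le_w lt_w.
  rewrite (@le_trans _ _ (\sum_(i < k) normc (phi (d + i)%N) * r ^+ (d + i))) //.
    by apply: ler_sum => i _; rewrite normcM normcX zr.
  lra.
pose N := (d + M).+1; have N0 : (0 < N)%N by [].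
pose P := trunc d phi * trunc M g.
have szP : (size P <= N)%N.
  apply: leq_trans (size_polyMleq _ _) _.
  rewrite (leq_trans (leq_pred _)) // leqW // leq_add // size_poly //.
pose w k : C := r%:C * zeta R N ^+ k.
have wr k : normc (w k) = r by rewrite rnorm // normc_zetaX.
have PE k : P.[w k] = \sum_(n < N) (P`_n * r%:C ^+ n) * (zeta R N ^+ k) ^+ n.
  rewrite (horner_coef_wide _ szP); apply: eq_bigr => n _.
  by rewrite /w exprMn mulrA.
have gE k : psum g (w k) M = \sum_(n < N)
    ((if (n < M)%N then g n * r%:C ^+ n else 0)) * (zeta R N ^+ k) ^+ n.
  have MN : (M <= N)%N by rewrite leqW // leq_addl.
  rewrite /psum (big_ord_widen N (fun n => g n * w k ^+ n)) // big_mkcond /=.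
  by apply: eq_bigr => n _; case: ifP; rewrite ?mul0r // /w exprMn mulrA.
have p1 := parseval (fun n => P`_n * r%:C ^+ n) N0.
have p2 := parseval (fun n => if (n < M)%N then g n * r%:C ^+ n else 0) N0.
have sqn (c : C) n : normc (c * r%:C ^+ n) ^+ 2 = normc c ^+ 2 * (r ^+ 2) ^+ n.
  rewrite normcM normcX normc_real (ger0_norm (ltW r0)) exprMn.
  by rewrite -!exprM mulnC.
have N0R : 0 < N%:R :> R by rewrite ltr0n.
have MN : (M <= N)%N by rewrite leqW // leq_addl.
rewrite -(ler_pM2l N0R).
apply: (@le_trans _ _ (N%:R * \sum_(n < N) normc (P`_n * r%:C ^+ n) ^+ 2)).
  rewrite ler_pM2l // (big_ord_widen N
    (fun n => normc ((phi * g) n) ^+ 2 * (r ^+ 2) ^+ n)) // big_mkcond.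
  apply: ler_sum => n _; rewrite sqn; case: ifP => nM.
    have -> // : (phi * g) n = P`_n.
    rewrite (fpsM_trunc _ _ nM); apply: eq_coefM => i le_in //.
    have iM : (i < M)%N := leq_ltn_trans le_in nM.
    by rewrite !coef_trunc // (leq_trans iM).
  by rewrite mulr_ge0 ?sqr_ge0 // exprn_ge0 // sqr_ge0.
apply: (@le_trans _ _ ((1 + e) ^+ 2 *
    \sum_(k < N) normc (psum g (w k) M) ^+ 2)).
  rewrite -p1 mulr_sumr; apply: ler_sum => k _; rewrite -PE /P hornerM.
  rewrite /trunc !horner_poly -/(psum phi (w k) d) -/(psum g (w k) M).
  rewrite normcM exprMn ler_wpM2r ?sqr_ge0 //.
  rewrite ler_pXn2r ?nnegrE ?normc_ge0 ?psum_le //.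
  by rewrite addr_ge0 // ltW.
under eq_bigr do rewrite gE.
rewrite p2 mulrCA ler_pM2l // ler_wpM2l ?sqr_ge0 //.
rewrite /l2 (big_ord_widen N (fun n => normc (g n) ^+ 2)) // [leRHS]big_mkcond /=.
apply: ler_sum => n _; case: ifP => _; last by rewrite normc0 expr0n.
rewrite sqn ler_piMr ?sqr_ge0 //.
by rewrite -exprM exprn_ile1 ?(ltW r0) ?(ltW r1).
Qed.

(** Multiplication by a function bounded by 1 is a contraction, even on
    truncations: let the radius tend to 1 in [contraction_radius]. *)
Lemma multiplication_contraction M g : l2 M (phi * g) <= l2 M g.
Proof.
set X := l2 M (phi * g); set G := l2 M g.
have X0 : 0 <= X := l2_ge0 _ _.
have G0 : 0 <= G := l2_ge0 _ _.
have bound d : 0 < d -> d < 1 -> X * (1 - (2 * M)%N%:R * d) <= (1 + d) ^+ 2 * G.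
  move=> d0 d1; have := @contraction_radius (1 - d) d M g.
  rewrite subr_gt0 gtrBl d1 d0 => /(_ isT isT isT); apply: le_trans.
  rewrite mulr_suml; apply: ler_sum => n _; rewrite ler_wpM2l ?sqr_ge0 //.
  apply: le_trans (bernoulli _ (ltW d0) (ltW d1)) _.
  rewrite -exprM ler_wiXn2l ?subr_ge0 ?(ltW d1) ?gerBl ?(ltW d0) //.
  by rewrite leq_mul2l /= ltnW.
apply/ler_addgt0Pr => e e0.
pose K := (2 * M)%N%:R * X + 3 * G + 1.
have K0 : 0 < K.
  have : 0 <= (2 * M)%N%:R * X by rewrite mulr_ge0 // ler0n.
  rewrite /K; lra.
pose d := Num.min (1 / 2) (e / K).
have d0 : 0 < d by rewrite lt_min divr_gt0 // divr_gt0.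
have d1 : d <= 1 / 2 by rewrite ge_min lexx.
have dK : d * K <= e by rewrite -ler_pdivlMr // ge_min lexx orbT.
have d1' : d < 1 by lra.
have := bound d d0 d1'; move: dK; rewrite /K.
move: ((2 * M)%N%:R) => m; move=> dK.
have dG : 0 <= d * (1 - d) * G by rewrite !mulr_ge0 ?subr_ge0 // ltW.
have : (1 + d) ^+ 2 * G <= G + 3 * d * G by rewrite expr2; nra.
nra.
Qed.

(** Littlewood's subordination principle, on truncations.  By [fcomp_shift] the
    composition is the constant term plus [phi * G]; since [phi] vanishes at 0
    the two parts are orthogonal and only the first [M] coefficients of [G]
    matter, so that [multiplication_contraction] and induction conclude. *)
Lemma littlewood M g : phi 0%N = 0 -> l2 M (fcomp phi g) <= l2 M g.
Proof.
move=> phi0; elim: M g => [|M IH] g; first by rewrite /l2 !big_ord0.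
pose G := fcomp phi (fdrop 1 g).
pose G' : fps C := FPS (fun n => if (n < M)%N then G n else 0).
have phiG n : (n <= M)%N -> (phi * G) n = (phi * G') n.
  move=> nM; rewrite !fpsME !big_ord_recl phi0 !mul0r !add0r.
  apply: eq_bigr => i _; rewrite /= ifT // /bump /= add1n.
  by have := ltn_ord i; lia.
rewrite (fcomp_shift phi0) -/G.
apply: (@le_trans _ _ (normc (g 0%N) ^+ 2 + l2 M.+1 (phi * G'))).
  have fC0 : fC (g 0%N) 0%N = g 0%N by rewrite /= coefC.
  have fCS n : fC (g 0%N) n.+1 = 0 by rewrite /= coefC.
  have phiG'0 : (phi * G') 0%N = 0.
    by rewrite fpsME big_ord_recl big_ord0 phi0 mul0r addr0.
  rewrite {1}/l2 big_ord_recl fpsDE fC0 phiG // phiG'0 addr0 lerD2l.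
  rewrite /l2 [leRHS]big_ord_recl -[leLHS]add0r lerD ?sqr_ge0 //.
  by apply: ler_sum => n _; rewrite lift0 fpsDE fCS add0r phiG.
rewrite [in leRHS]/l2 big_ord_recl lerD2l.
apply: le_trans (multiplication_contraction _ _) _.
rewrite /l2 big_ord_recr /= ltnn normc0 expr0n addr0.
have -> : \sum_(i < M) normc (if (i < M)%N then G i else 0) ^+ 2 = l2 M G.
  by apply: eq_bigr => i _; rewrite ltn_ord.
apply: le_trans (IH _) _; rewrite /l2.
by apply: ler_sum => n _; rewrite /= addn1 /bump /= add1n.
Qed.

Hypothesis f_lt1 : forall z, normc z < 1 -> normc (f z) < 1.
Hypothesis phi0 : phi 0%N = 0.

Let evals_comp_poly (q : {poly C}) :
  evals (fcomp phi (fpoly q)) (fun z => q.[f z]).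
Proof.
elim/poly_ind: q => [|q c IH].
  have := evalsC (0 : C); rewrite rmorph0 (_ : fcomp phi _ = 0).
    by move=> H z; rewrite horner0; exact: H.
  by have := fcompC phi 0; rewrite !rmorph0.
have -> : fcomp phi (fpoly (q * 'X + c%:P)) = fcomp phi (fpoly q) * phi + fC c.
  by rewrite rmorphD rmorphM fcompD (fcompM phi0) (fcompX phi0) (fcompC phi).
move=> z z1; rewrite hornerMXaddC.
exact: (evalsD (evalsM IH phif) (evalsC c) z1).
Qed.

(** The formal composition computes the composition of functions: split [a] into
    a polynomial, for which this is algebra, and a tail of small l2 norm, whose
    composition stays small by [littlewood]. *)
Lemma evals_fcomp a F B : (forall M, l2 M a <= B) -> evals a F ->
  evals (fcomp phi a) (fun z => F (f z)).
Proof.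
move=> aB aF z z1 e e0; set r := normc z.
have r0 : 0 <= r := normc_ge0 z.
have r1' : 0 < 1 - r by rewrite subr_gt0.
pose eta := e / 4 * (1 - r).
have eta0 : 0 < eta by rewrite mulr_gt0 // divr_gt0.
have [d1 Hd1] := nondecreasing_tail (l2_homo a) aB (exprn_gt0 2 eta0).
have e4 : 0 < e / 4 by rewrite divr_gt0.
have [d2 Hd2] := aF _ (f_lt1 z1) _ e4.
pose d := maxn d1 d2; pose t := a - fpoly (trunc d a).
have tn n : t n = if (n < d)%N then 0 else a n.
  rewrite fpsBE /= coef_poly; case: ifP; by rewrite ?subrr ?subr0.
have tM M : l2 M t <= eta ^+ 2.
  apply: (@le_trans _ _ (l2 (maxn d M) a - l2 d a)); last first.
    have := Hd1 _ (leq_trans (leq_maxl d1 d2) (leq_maxl d M)).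
    have := l2_homo a (leq_maxl d1 d2 : (d1 <= d)%N).
    by move=> /= ? ?; lra.
  apply: le_trans (l2_homo t (leq_maxr d M)) _ => /=.
  rewrite lerBrDl /l2 (big_ord_widen (maxn d M) (fun n => normc (a n) ^+ 2)) ?leq_maxl //.
  rewrite big_mkcond -big_split; apply: ler_sum => n _.
  by rewrite tn; case: ifP; rewrite ?normc0 ?expr0n /= ?addr0 ?add0r ?lexx.
have coef_le n : normc (fcomp phi t n) <= eta.
  rewrite -(@ler_pXn2r _ 2) ?nnegrE ?normc_ge0 ?(ltW eta0) //.
  exact: le_trans (l2_coef _ _) (le_trans (littlewood _ _ phi0) (tM _)).
have aE : a = fpoly (trunc d a) + t by rewrite /t addrC subrK.
have [N HN] := evals_comp_poly (trunc d a) z1 e4.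
exists N => n Nn.
have psE : psum (fcomp phi a) z n =
    psum (fcomp phi (fpoly (trunc d a))) z n + psum (fcomp phi t) z n.
  rewrite {1}aE fcompD /psum -big_split /=.
  by apply: eq_bigr => i _; rewrite [LHS]mulrDl.
have t_le : normc (psum (fcomp phi t) z n) <= e / 4.
  apply: le_trans (wnorm_psum _ _ _) _.
  apply: (@le_trans _ _ (eta * (1 - r)^-1)).
    apply: le_trans (ler_wpM2l (ltW eta0) (geometric_bound n r0 z1)).
    rewrite mulr_sumr; apply: ler_sum => i _.
    by rewrite ler_wpM2r ?exprn_ge0.
  by rewrite /eta mulfK // gt_eqF.
have := HN n Nn; have := Hd2 d (leq_maxr _ _).
rewrite /trunc horner_poly -/(psum a (f z) d) -/(trunc d a) psE.
move: (psum (fcomp phi (fpoly _)) z n) (psum _ z n) t_le => x y yle.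
move: (psum a (f z) d) => u H1 H2.
have := ler_normc_add (x + y - u) (u - F (f z)); rewrite addrA subrK.
have := ler_normc_add (x - u) y; rewrite addrAC => ? ?; lra.
Qed.

End Subordination.

(** * Goursat's lemma for trapezoid sums *)

Section Goursat.
Variable R : realType.
Local Notation C := R[i].
Implicit Types (f g : C -> C) (gam : R -> C) (P : R -> R -> C).

(** Complex differentiability with real tolerances and without quotients. *)
Definition diff_at f z d := forall e : R, 0 < e -> exists2 eta : R, 0 < eta &
  forall w, normc (w - z) < eta ->
    normc (f w - (f z + d * (w - z))) <= e * normc (w - z).

Lemma derivable_diff_at f z : derivable f z 1 -> exists d, diff_at f z d.
Proof.
move=> /cvg_ex [d /= Hd]; exists d => e e0.
have e0C : (0 : C) < e%:C by rewrite (ltcR 0 e).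
move/cvgrPdist_lt : Hd => /(_ _ e0C).
rewrite /dnbhs /within /= => -[eta]; rewrite /ball_ /=.
rewrite ltcE /= => /andP[/eqP Ie eta0] H.
have etaE : eta = (complex.Re eta)%:C by apply/eqP; rewrite eq_complex /= Ie !eqxx.
exists (complex.Re eta) => // w wz.
have [->|wz0] := eqVneq w z.
  by rewrite subrr normc0 mulr0 addr0 subrr normc0 mulr0.
have wz0' : w - z != 0 by rewrite subr_eq0.
have := H (w - z); rewrite /= sub0r normrN normcE {1}etaE ltcR => /(_ wz wz0').
rewrite normcE ltcR (_ : (w - z)%:A + z = w); last first.
  by rewrite -[_%:A]/((w - z) * 1) mulr1 subrK.
rewrite -[_ *: _]/((w - z)^-1 * _) => H2.
have -> : f w - (f z + d * (w - z)) = - ((d - (w - z)^-1 * (f w - f z)) * (w - z)).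
  by rewrite mulrBl mulrAC mulVf // mul1r; ring.
by rewrite normc_opp normcM ler_wpM2r ?normc_ge0 // ltW.
Qed.

(** Twice the trapezoid rule for the integral of [f] from [u] to [v].  It is
    exact on affine functions, so the sum over any closed polygon of an affine
    function is exactly 0; Goursat's argument then works on finite sums. *)
Definition trapezoid f (u v : C) : C := (f u + f v) * (v - u).

Fixpoint path_sum f n gam (t s : R) : C :=
  if n is n'.+1 then
    path_sum f n' gam t (s / 2) + path_sum f n' gam (t + s / 2) (s / 2)
  else trapezoid f (gam t) (gam (t + s)).

Lemma path_sumD f g n gam t s :
  path_sum (fun z => f z + g z) n gam t s =
  path_sum f n gam t s + path_sum g n gam t s.
Proof.
elim: n t s => [|n IH] t s /=; first by rewrite /trapezoid; ring.
by rewrite !IH; ring.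
Qed.

Lemma path_sum_affine (c d : C) n gam t s :
  path_sum (fun z => c + d * z) n gam t s =
  (c *+ 2 * gam (t + s) + d * gam (t + s) ^+ 2) -
  (c *+ 2 * gam t + d * gam t ^+ 2).
Proof.
elim: n t s => [|n IH] t s /=; first by rewrite /trapezoid; ring.
rewrite !IH (_ : t + s / 2 + s / 2 = t + s); last by field.
by ring.
Qed.

Lemma path_sum_bound f n gam t s L D : 0 <= s -> 0 <= D ->
  (forall u v, t <= u -> u <= v -> v <= t + s ->
     normc (gam v - gam u) <= L * (v - u)) ->
  (forall u, t <= u -> u <= t + s -> normc (f (gam u)) <= D) ->
  normc (path_sum f n gam t s) <= 2 * D * L * s.
Proof.
elim: n t s => [|n IH] t s s0 D0 lip bound /=.
  rewrite /trapezoid normcM.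
  have b1 : normc (f (gam t)) <= D by apply: bound; lra.
  have b2 : normc (f (gam (t + s))) <= D by apply: bound; lra.
  have l1 : normc (gam (t + s) - gam t) <= L * (t + s - t) by apply: lip; lra.
  have := ler_normc_add (f (gam t)) (f (gam (t + s))) => b3.
  rewrite -mulrA; apply: ler_pM; rewrite ?normc_ge0 //; first lra.
  by apply: le_trans l1 _; rewrite addrAC subrr add0r.
have h0 : 0 <= s / 2 by rewrite divr_ge0.
apply: le_trans (ler_normc_add _ _) _.
have -> : 2 * D * L * s = 2 * D * L * (s / 2) + 2 * D * L * (s / 2) by field.
by apply: lerD; (apply: IH => // [u v tu uv vt|u tu ut];
  [apply: lip => //; lra|apply: bound => //; lra]).
Qed.

Definition square_sum f P n x y s : C :=
  path_sum f n (fun u => P u y) x s + path_sum f n (fun v => P (x + s) v) y s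
  - path_sum f n (fun u => P u (y + s)) x s - path_sum f n (fun v => P x v) y s.

Lemma square_sum_split f P n x y s : let h := s / 2 in
  square_sum f P n.+1 x y s =
  square_sum f P n x y h + square_sum f P n (x + h) y h +
  (square_sum f P n x (y + h) h + square_sum f P n (x + h) (y + h) h).
Proof.
move=> h; rewrite /square_sum /= -/h.
have hx : x + h + h = x + s by rewrite /h; field.
have hy : y + h + h = y + s by rewrite /h; field.
by rewrite hx hy; ring.
Qed.

Lemma square_sum_affine c d P n x y s :
  square_sum (fun z => c + d * z) P n x y s = 0.
Proof. by rewrite /square_sum !path_sum_affine; ring. Qed.

Lemma square_sumD f g P n x y s :
  square_sum (fun z => f z + g z) P n x y s =
  square_sum f P n x y s + square_sum g P n x y s.
Proof. by rewrite /square_sum !path_sumD; ring. Qed.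

Lemma square_sum_bound f P n x y s L D : 0 <= s -> 0 <= D ->
  (forall u u' v v', x <= u <= x + s -> x <= u' <= x + s ->
     y <= v <= y + s -> y <= v' <= y + s ->
     normc (P u v - P u' v') <= L * (`|u - u'| + `|v - v'|)) ->
  (forall u v, x <= u <= x + s -> y <= v <= y + s -> normc (f (P u v)) <= D) ->
  normc (square_sum f P n x y s) <= 8 * D * L * s.
Proof.
move=> s0 D0 lip bound.
have hor v : y <= v <= y + s ->
    normc (path_sum f n (fun u => P u v) x s) <= 2 * D * L * s.
  move=> yv; apply: path_sum_bound => // [u u' xu uu' u's|u xu us].
    have := @lip u' u v v; rewrite subrr normr0 addr0 ger0_norm ?subr_ge0 //.
    by apply=> //; apply/andP; split; lra.
  by apply: bound => //; apply/andP.
have ver u : x <= u <= x + s ->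
    normc (path_sum f n (fun v => P u v) y s) <= 2 * D * L * s.
  move=> xu; apply: path_sum_bound => // [v v' yv vv' v's|v yv vs].
    have := @lip u u v' v; rewrite subrr normr0 add0r ger0_norm ?subr_ge0 //.
    by apply=> //; apply/andP; split; lra.
  by apply: bound => //; apply/andP.
have h1 : normc (path_sum f n (fun u => P u y) x s) <= 2 * D * L * s.
  by apply: hor; apply/andP; split; lra.
have h2 : normc (path_sum f n (fun u => P u (y + s)) x s) <= 2 * D * L * s.
  by apply: hor; apply/andP; split; lra.
have v1 : normc (path_sum f n (fun v => P x v) y s) <= 2 * D * L * s.
  by apply: ver; apply/andP; split; lra.
have v2 : normc (path_sum f n (fun v => P (x + s) v) y s) <= 2 * D * L * s.
  by apply: ver; apply/andP; split; lra.
rewrite /square_sum; apply: le_trans (ler_normc_sub _ _) _.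
have := ler_normc_sub (path_sum f n (fun u => P u y) x s +
  path_sum f n (fun v => P (x + s) v) y s) (path_sum f n (fun u => P u (y + s)) x s).
have := ler_normc_add (path_sum f n (fun u => P u y) x s)
  (path_sum f n (fun v => P (x + s) v) y s).
by lra.
Qed.

(** Counts [u] once for each of the two half-open intervals with end points [x]
    and [x + s]: additive when the interval is cut, and at least 1 as soon as
    [u] lies in the closed interval. *)
Definition half_open_count (u x s : R) : R :=
  ((x <= u) && (u < x + s))%:R + ((x < u) && (u <= x + s))%:R.

Lemma half_open_count_split u x s : 0 < s ->
  half_open_count u x s =
  half_open_count u x (s / 2) + half_open_count u (x + s / 2) (s / 2).
Proof.
move=> s0; rewrite /half_open_count.
have -> : x + s / 2 + s / 2 = x + s by field.
have lt1 : x < x + s / 2 by lra.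
have lt2 : x + s / 2 < x + s by lra.
move: (x + s / 2) (x + s) lt1 lt2 => m r xm mr.
have [mu|um] := leP m u; have [mu'|um'] := ltP m u.
- have -> : x <= u by lra. have -> : x < u by lra.
  by rewrite /= !add0r.
- have -> : x <= u by lra. have -> : x < u by lra.
  have -> : u < r by lra. have -> : u <= r by lra.
  by rewrite /= add0r addr0.
- by have := lt_trans um mu'; rewrite ltxx.
- have -> : u < r by lra. have -> : u <= r by lra.
  by rewrite !andbT /= !addr0.
Qed.

Lemma half_open_count_ge0 u x s : 0 <= half_open_count u x s.
Proof. by rewrite /half_open_count addr_ge0. Qed.

Lemma half_open_count_ge1 u x s : 0 < s -> x <= u <= x + s ->
  1 <= half_open_count u x s.
Proof.
move=> s0 /andP[xu us]; rewrite /half_open_count xu us andbT /=.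
have [_|us'] := ltP u (x + s); first by rewrite lerDl.
have -> : x < u by lra.
by rewrite lerDr.
Qed.

Lemma half_open_count_le2 u x s : half_open_count u x s <= 2.
Proof. by rewrite -[2]/(1 + 1) lerD // lern1 leq_b1. Qed.

Lemma nested_intervals (x s : nat -> R) :
  (forall j, 0 <= s j) -> (forall j, x j <= x j.+1) ->
  (forall j, x j.+1 + s j.+1 <= x j + s j) ->
  exists l, forall j, x j <= l <= x j + s j.
Proof.
move=> s0 xS xsS.
have xh : {homo x : m n / (m <= n)%N >-> m <= n}.
  by apply: homo_leq => //; exact: le_trans.
have xsh : {homo (fun j => x j + s j) : m n / (m <= n)%N >-> m >= n}.
  apply: homo_leq => //; by move=> a b c ba cb; exact: le_trans cb ba.
have le_x k j : x k <= x j + s j.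
  apply: le_trans (xh _ _ (leq_maxl k j)) _.
  apply: le_trans (xsh _ _ (leq_maxr k j)) => /=.
  by rewrite lerDl.
have sx : has_sup (range x).
  by split; [exists (x 0%N), 0%N|exists (x 0%N + s 0%N) => _ [k _ <-]].
exists (sup (range x)) => j; apply/andP; split.
  by apply: (ub_le_sup sx.2); exists j.
by apply: ge_sup => [|_ [k _ <-]]; [exists (x 0%N), 0%N|].
Qed.

(** Goursat's bisection.  The boundary sum over a square is compared with [mass],
    the area plus point masses, which is additive under quartering.  If the
    comparison fails for a square it fails for one of its quarters, hence along
    a sequence of nested squares; it holds near a point of differentiability
    because of the area term, and near an exceptional point, where [f] is only
    bounded, because of the point mass.  The exceptional points are those
    sent to the same complex number by polar coordinates, where the angle is
    only determined up to a turn. *)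
Section Bisection.
Variables (f : C -> C) (P : R -> R -> C) (L x0 y0 : R).
Hypothesis L0 : 0 < L.
Hypothesis lip : forall u u' v v', 0 <= u <= 1 -> 0 <= u' <= 1 ->
  0 <= v <= 1 -> 0 <= v' <= 1 ->
  normc (P u v - P u' v') <= L * (`|u - u'| + `|v - v'|).
Hypothesis regular : forall x y, 0 <= x <= 1 -> 0 <= y <= 1 ->
  (exists d, diff_at f (P x y) d) \/
  [/\ x = x0, (y = y0 \/ y = y0 + 1 \/ y = y0 - 1) &
   exists M eta : R, [/\ 0 <= M, 0 < eta &
     forall w, normc (w - P x y) < eta -> normc (f w) <= M]].

Let mass x y s : R := s ^+ 2 + half_open_count x0 x s *
  (half_open_count y0 y s + half_open_count (y0 + 1) y s +
   half_open_count (y0 - 1) y s).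

Let mass_split x y s : 0 < s -> let h := s / 2 in
  mass x y s = mass x y h + mass (x + h) y h +
    (mass x (y + h) h + mass (x + h) (y + h) h).
Proof.
move=> s0 h; rewrite /mass (half_open_count_split x0 x s0).
rewrite !(half_open_count_split _ y s0) -/h.
have -> : s = h * 2 by rewrite /h divfK.
by ring.
Qed.

Variable e : R.
Hypothesis e0 : 0 < e.

Let good x y s := exists N, forall n, (N <= n)%N ->
  normc (square_sum f P n x y s) <= e * mass x y s.

Let good_split x y s : 0 < s -> let h := s / 2 in
  good x y h -> good (x + h) y h -> good x (y + h) h -> good (x + h) (y + h) h ->
  good x y s.
Proof.
move=> s0 h [N1 H1] [N2 H2] [N3 H3] [N4 H4].
exists (maxn (maxn N1 N2) (maxn N3 N4)).+1 => -[//|n].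
rewrite ltnS !geq_max => /andP[/andP[n1 n2] /andP[n3 n4]].
rewrite square_sum_split mass_split //= -/h.
apply: le_trans (ler_normc_add _ _) _; rewrite mulrDr; apply: lerD.
  apply: le_trans (ler_normc_add _ _) _; rewrite mulrDr.
  by apply: lerD; [exact: H1|exact: H2].
apply: le_trans (ler_normc_add _ _) _; rewrite mulrDr.
by apply: lerD; [exact: H3|exact: H4].
Qed.

Let side j : R := 2^-1 ^+ j.

Let side_gt0 j : 0 < side j.
Proof. by rewrite exprn_gt0 // invr_gt0. Qed.

Let sideS j : side j / 2 = side j.+1.
Proof. by rewrite /side exprSr. Qed.

Let next j (q : R * R) : R * R :=
  let h := side j.+1 in
  if ~~ `[< good q.1 q.2 h >] then q
  else if ~~ `[< good (q.1 + h) q.2 h >] then (q.1 + h, q.2)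
  else if ~~ `[< good q.1 (q.2 + h) h >] then (q.1, q.2 + h)
  else (q.1 + h, q.2 + h).

Let corner := fix corner j : R * R :=
  if j is j'.+1 then next j' (corner j') else (0, 0).

Let corner_bad : ~ good 0 0 1 ->
  forall j, ~ good (corner j).1 (corner j).2 (side j).
Proof.
move=> bad; elim=> [|j IH]; first by rewrite /side expr0.
rewrite /= /next; move: (corner j) IH => [x y] /= IH.
case: asboolP => //= g1; case: asboolP => //= g2; case: asboolP => //= g3 g4.
by apply: IH; apply: good_split; rewrite ?sideS.
Qed.

Let corner_step j :
  [/\ (corner j).1 <= (corner j.+1).1,
      (corner j.+1).1 + side j.+1 <= (corner j).1 + side j,
      (corner j).2 <= (corner j.+1).2 &
      (corner j.+1).2 + side j.+1 <= (corner j).2 + side j].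
Proof.
have := side_gt0 j.+1; have sE : side j = side j.+1 + side j.+1.
  by rewrite -sideS; field.
rewrite sE /= /next; move: (corner j) (side j.+1) => [x y] h /= h0.
by do ![case: ifP => _ /=]; split; lra.
Qed.

Lemma goursat_bound : exists N, forall n, (N <= n)%N ->
  normc (square_sum f P n 0 0 1) <= e * 13.
Proof.
suff [N HN] : good 0 0 1.
  exists N => n /HN /le_trans; apply; rewrite ler_pM2l // /mass expr1n.
  have H u v : half_open_count u v 1 <= 2 := half_open_count_le2 _ _ _.
  have H0 u v : 0 <= half_open_count u v 1 := half_open_count_ge0 _ _ _.
  have := H0 x0 0; have := H x0 0; have := H y0 0; have := H (y0 + 1) 0.
  have := H (y0 - 1) 0; have := H0 y0 0; have := H0 (y0 + 1) 0.
  have := H0 (y0 - 1) 0.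
  move: (half_open_count x0 0 1) (half_open_count y0 0 1).
  move: (half_open_count (y0 + 1) 0 1) (half_open_count (y0 - 1) 0 1).
  by move=> b c a d *; nra.
apply: contrapT => bad; have cbad := corner_bad bad.
have [lx Hx] : exists l, forall j, (corner j).1 <= l <= (corner j).1 + side j.
  apply: nested_intervals => j; first exact: ltW.
    by have [] := corner_step j.
  by have [] := corner_step j.
have [ly Hy] : exists l, forall j, (corner j).2 <= l <= (corner j).2 + side j.
  apply: nested_intervals => j; first exact: ltW.
    by have [] := corner_step j.
  by have [] := corner_step j.
have unit j : [/\ 0 <= (corner j).1, (corner j).1 + side j <= 1,
                  0 <= (corner j).2 & (corner j).2 + side j <= 1].
  elim: j => [|j [? ? ? ?]]; first by rewrite /side expr0 /= add0r.
  by have [? ? ? ?] := corner_step j; split; lra.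
have small (r : R) : 0 < r -> exists j, side j < r.
  move=> r0; have [N HN] := @expr_small R 2^-1 r (ltac:(lra)) (ltac:(lra)) r0.
  by exists N; apply: HN.
have lx01 : 0 <= lx <= 1.
  by have := Hx 0%N; rewrite /side expr0 /= add0r.
have ly01 : 0 <= ly <= 1.
  by have := Hy 0%N; rewrite /side expr0 /= add0r.
have lipj j : forall u u' v v',
    (corner j).1 <= u <= (corner j).1 + side j ->
    (corner j).1 <= u' <= (corner j).1 + side j ->
    (corner j).2 <= v <= (corner j).2 + side j ->
    (corner j).2 <= v' <= (corner j).2 + side j ->
    normc (P u v - P u' v') <= L * (`|u - u'| + `|v - v'|).
  move=> u u' v v' /andP[? ?] /andP[? ?] /andP[? ?] /andP[? ?].
  by have [? ? ? ?] := unit j; apply: lip; apply/andP; split; lra.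
have near_lim j u v : (corner j).1 <= u <= (corner j).1 + side j ->
    (corner j).2 <= v <= (corner j).2 + side j ->
    normc (P u v - P lx ly) <= 2 * L * side j.
  move=> ui vi; apply: le_trans (lipj j _ _ _ _ ui (Hx j) vi (Hy j)) _.
  have -> : 2 * L * side j = L * (side j + side j) by ring.
  rewrite ler_pM2l //; move/andP: ui => [? ?]; move/andP: vi => [? ?].
  have /andP[? ?] := Hx j; have /andP[? ?] := Hy j.
  by apply: lerD; rewrite ler_norml; apply/andP; split; lra.
have [[d Hd]|[xE yE [M [eta [M0 eta0 HM]]]]] := regular lx01 ly01.
(* [16]: four sides, factor 2 from [trapezoid], and diameter [2 * L * side]. *)
- pose e' := e / (16 * L ^+ 2).
  have L20 : 0 < 16 * L ^+ 2 by rewrite mulr_gt0 // exprn_gt0.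
  have e'0 : 0 < e' by rewrite divr_gt0.
  have [eta eta0 Heta] := Hd e' e'0.
  have [j Hj] := small (eta / (2 * L)) (divr_gt0 eta0 (mulr_gt0 (ltr0n R 2) L0)).
  apply: (cbad j); exists 0%N => n _.
  pose z0 := P lx ly; pose g z := f z - (f z0 + d * (z - z0)).
  have -> : square_sum f P n (corner j).1 (corner j).2 (side j) =
            square_sum g P n (corner j).1 (corner j).2 (side j).
    rewrite -[RHS]addr0 -(square_sum_affine (f z0 - d * z0) d P n
      (corner j).1 (corner j).2 (side j)) -square_sumD.
    congr (square_sum _ _ _ _ _ _); apply/funext => z; rewrite /g; ring.
  have sj := side_gt0 j.
  have D0 : 0 <= e' * (2 * L * side j).
    by rewrite mulr_ge0 ?(ltW e'0) // !mulr_ge0 // ltW.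
  apply: le_trans (@square_sum_bound g P n _ _ _ L _ (ltW sj) D0 (lipj j) _) _.
    move=> u v ui vi; have dist := near_lim j u v ui vi.
    apply: le_trans (Heta _ _) _; last by rewrite ler_pM2l.
    apply: le_lt_trans dist _; rewrite mulrC -ltr_pdivlMr ?mulr_gt0 //.
  have -> : 8 * (e' * (2 * L * side j)) * L * side j =
            e' * (16 * L ^+ 2) * side j ^+ 2 by ring.
  rewrite divfK ?gt_eqF // ler_pM2l // lerDl mulr_ge0 ?half_open_count_ge0 //.
  by rewrite !addr_ge0 ?half_open_count_ge0.
- have r0 : 0 < Num.min (eta / (2 * L)) (e / (8 * M * L + 1)).
    rewrite lt_min !divr_gt0 ?mulr_gt0 // ltr_wpDl // !mulr_ge0 // ltW //.
  have [j Hj] := small _ r0; move: Hj; rewrite lt_min => /andP[Hj1 Hj2].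
  apply: (cbad j); exists 0%N => n _; have sj := side_gt0 j.
  apply: le_trans (@square_sum_bound f P n _ _ _ L M (ltW sj) M0 (lipj j) _) _.
    move=> u v ui vi; apply: HM; apply: le_lt_trans (near_lim j u v ui vi) _.
    by rewrite mulrC -ltr_pdivlMr ?mulr_gt0.
  apply: (@le_trans _ _ e).
    have D0 : 0 < 8 * M * L + 1.
      by rewrite ltr_wpDl // !mulr_ge0 // ltW.
    move: Hj2; rewrite ltr_pdivlMr // mulrDr mulr1 => H.
    by have := sj; rewrite mulrC; lra.
  rewrite ler_peMr ?(ltW e0) // /mass.
  have c1 := half_open_count_ge1 sj (Hx j); rewrite xE in c1.
  have c2 := half_open_count_ge1 sj (Hy j).
  have s2 : 0 <= side j ^+ 2 by rewrite sqr_ge0.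
  have p0 := half_open_count_ge0 y0 (corner j).2 (side j).
  have p1 := half_open_count_ge0 (y0 + 1) (corner j).2 (side j).
  have p2 := half_open_count_ge0 (y0 - 1) (corner j).2 (side j).
  move: (half_open_count x0 _ _) c1 => a c1.
  suff : 1 <= half_open_count y0 (corner j).2 (side j) +
     half_open_count (y0 + 1) (corner j).2 (side j) +
     half_open_count (y0 - 1) (corner j).2 (side j).
    by move: (_ + _ + _) (side j ^+ 2) s2 => b s2 s20 b1; nra.
  by case: yE c2 => [->|[->|->]] c2; lra.
Qed.

End Bisection.
End Goursat.

(** * Holomorphic functions are sums of power series *)

Section UltraLimit.
Variables (R : realType) (U : set_system nat).
Local Notation C := R[i].
Hypothesis U_ultra : UltraFilter U.

Let U_filter : ProperFilter U. Proof. exact: ultra_proper. Qed.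

(** Limits along an ultrafilter provide Taylor coefficients as limits of discrete
    Fourier coefficients, without having to prove that those converge. *)
Lemma real_ultralimit (v : nat -> R) B : (forall n, `|v n| <= B) ->
  exists l, forall e, 0 < e -> U [set n | `|v n - l| < e].
Proof.
move=> vB; pose A := [set t : R | U [set n | t <= v n]].
have AB : A (- B).
  rewrite /A /= (_ : [set n | _] = setT); first exact: filterT.
  by apply/seteqP; split=> n //= _; have := vB n; rewrite ler_norml => /andP[].
have ubA : ubound A B.
  move=> t At; have [n /= tn] := filter_ex At.
  by apply: le_trans tn _; have := vB n; rewrite ler_norml => /andP[].
have sA : has_sup A by split; [exists (- B)|exists B].
exists (sup A) => e e0.
have [t At tlt] := sup_adherent e0 sA.
have notA : ~ A (sup A + e / 2).
  by move=> /(ub_le_sup sA.2); rewrite gerDl; lra.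
have [//|Uc] := @in_ultra_setVsetC _ _ [set n | sup A + e / 2 <= v n] U_ultra.
apply: filterS (filterI At Uc) => n [/= tv /negP]; rewrite -ltNge => vlt.
by rewrite ltr_norml; apply/andP; split; lra.
Qed.

Lemma complex_ultralimit (v : nat -> C) B : (forall n, normc (v n) <= B) ->
  exists l : C, forall e : R, 0 < e -> U [set n | normc (v n - l) < e].
Proof.
move=> vB.
have [x Hx] := @real_ultralimit (fun n => complex.Re (v n)) B
  (fun n => le_trans (normc_Re _) (vB n)).
have [y Hy] := @real_ultralimit (fun n => complex.Im (v n)) B
  (fun n => le_trans (normc_Im _) (vB n)).
exists (x +i* y) => e e0; have e2 : 0 < e / 2 by rewrite divr_gt0.
apply: filterS (filterI (Hx _ e2) (Hy _ e2)) => n [/= nx ny].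
apply: le_lt_trans (normc_ReIm _) _.
by move: nx ny; case: (v n) => a b /=; lra.
Qed.

Lemma ultralimit_sum (u : nat -> nat -> C) (l : nat -> C) L :
  (forall m, forall e : R, 0 < e -> U [set n | normc (u n m - l m) < e]) ->
  forall e : R, 0 < e ->
    U [set n | normc (\sum_(m < L) u n m - \sum_(m < L) l m) < e].
Proof.
move=> ul; elim: L => [|L IH] e e0.
  rewrite (_ : [set n | _] = setT); first exact: filterT.
  by apply/seteqP; split=> n //= _; rewrite !big_ord0 subrr normc0.
have e2 : 0 < e / 2 by rewrite divr_gt0.
apply: filterS (filterI (IH _ e2) (ul L _ e2)) => n [/= n1 n2].
rewrite !big_ord_recr /= opprD addrACA.
by apply: le_lt_trans (ler_normc_add _ _) _; lra.
Qed.

End UltraLimit.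

Section Uniqueness.
Variable R : realType.
Local Notation C := R[i].

Lemma psum_sub (a b : fps C) z n : psum (a - b) z n = psum a z n - psum b z n.
Proof.
rewrite /psum -sumrB; apply: eq_bigr => i _; exact: mulrBl.
Qed.

(** If the coefficients below [n] vanish, the [n]-th one is at most a constant
    times [t] for every small [t > 0]. *)
Lemma psum_null (d : fps C) (r : R) : 0 < r ->
  (forall z, normc z < r -> tends (psum d z) 0) -> d = 0.
Proof.
move=> r0 dz; pose s := r / 2.
have s0 : 0 < s by rewrite divr_gt0.
have ns : normc s%:C < r by rewrite normc_real ger0_norm ?ltW // /s; lra.
have [A A0 dA] := terms_bounded s0 (dz _ ns).
apply: fpsP => n; rewrite fps0E; elim/ltn_ind: n => n IH.
pose K := 2 * A / s ^+ n.+1.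
have K0 : 0 < K by rewrite divr_gt0 ?mulr_gt0 ?exprn_gt0.
have small t : 0 < t -> t <= s / 2 -> normc (d n) <= K * t.
  move=> t0 ts.
  have nt : normc t%:C = t by rewrite normc_real ger0_norm // ltW.
  have tr : normc t%:C < r by rewrite nt; move: ts; rewrite /s; lra.
  have q0 : 0 <= t / s by rewrite divr_ge0 // ltW.
  have q1 : t / s <= 1 / 2 by rewrite ler_pdivrMr //; lra.
  have bound : normc (0 - d n * t%:C ^+ n) <= A * (t / s) ^+ n.+1 * 2.
    apply: (tends_le (dz _ tr)); exists n.+1 => N nN.
    have [k ->] : exists k, N = (n.+1 + k)%N by exists (N - n.+1)%N; rewrite subnKC.
    rewrite /psum big_split_ord /= big_ord_recr /= big1 => [|i _]; last first.
      by rewrite IH ?mul0r.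
    rewrite add0r addrAC subrr add0r.
    apply: le_trans (ler_normc_sum _ _ _) _.
    apply: (@le_trans _ _ (A * (t / s) ^+ n.+1 * \sum_(i < k) (t / s) ^+ i)).
      rewrite mulr_sumr; apply: ler_sum => i _.
      rewrite normcM normcX nt -mulrA -exprD.
      have -> : normc (d (n.+1 + i)%N) * t ^+ (n.+1 + i) =
          normc (d (n.+1 + i)%N) * s ^+ (n.+1 + i) * (t / s) ^+ (n.+1 + i).
        by rewrite -mulrA -exprMn [s * _]mulrC divfK // gt_eqF.
      by rewrite ler_wpM2r ?exprn_ge0.
    rewrite ler_wpM2l ?mulr_ge0 ?exprn_ge0 ?(ltW A0) //.
    have q1' : t / s < 1 by lra.
    apply: le_trans (geometric_bound k q0 q1') _.
    by rewrite invf_ple ?posrE ?subr_gt0 //; lra.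
  move: bound; rewrite sub0r normc_opp normcM normcX nt.
  have -> : A * (t / s) ^+ n.+1 * 2 = K * t * t ^+ n.
    by rewrite /K expr_div_n [t ^+ n.+1]exprS; move: (s ^+ n.+1)^-1 => c; ring.
  by rewrite ler_pM2r // exprn_gt0.
apply/eqP; rewrite -normc_eq0 eq_le normc_ge0 andbT.
apply/ler_addgt0Pr => e e0; rewrite add0r.
pose t := Num.min (s / 2) (e / K).
have t0 : 0 < t by rewrite lt_min (divr_gt0 s0) // (divr_gt0 e0).
apply: le_trans (small t t0 _) _; first by rewrite ge_min lexx.
by rewrite mulrC -ler_pdivlMr // ge_min lexx orbT.
Qed.

Lemma psum_unique (a b : fps C) (F : C -> C) (r : R) : 0 < r ->
  (forall z, normc z < r -> tends (psum a z) (F z)) ->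
  (forall z, normc z < r -> tends (psum b z) (F z)) -> a = b.
Proof.
move=> r0 aF bF; apply/eqP; rewrite -subr_eq0; apply/eqP.
apply: (psum_null r0) => z zr.
have bN : tends (fun n => - psum b z n) (- F z).
  move=> e e0; have [N HN] := bF z zr e e0; exists N => n /HN.
  by rewrite -opprD normc_opp.
have := tendsD (aF z zr) bN; rewrite subrr; apply: tends_eq => n.
by rewrite psum_sub.
Qed.

Lemma evals_unique (a b : fps C) F : evals a F -> evals b F -> a = b.
Proof. by move=> aF bF; apply: (psum_unique ltr01 aF bF). Qed.

End Uniqueness.

Section Circle.
Variable R : realType.
Local Notation C := R[i].
Implicit Types (f : C -> C).

Lemma cis_lipschitz (s t : R) : normc (cis s - cis t) <= 2 * `|s - t|.
Proof.
have mvt (g dg : R -> R) (x y : R) : (forall u : R, is_derive u 1 g (dg u)) ->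
    continuous g -> (forall u, `|dg u| <= 1) -> x < y -> `|g x - g y| <= `|x - y|.
  move=> gd gc d1 xy.
  have [c _ E] := @MVT R g dg x y xy (fun u _ => gd u) (continuous_subspaceT gc).
  by rewrite [leRHS]distrC [leLHS]distrC E normrM ler_piMl ?normr_ge0.
have norm1 (c d : R) : c ^+ 2 + d ^+ 2 = 1 -> `|c| <= 1.
  move=> cd; have := sqr_ge0 d; rewrite ler_norml => d0.
  by apply/andP; split; nra.
wlog st : s t / s < t.
  move=> H; have [st|ts|->] := ltgtP s t; first exact: H.
    by rewrite normc_distC distrC; exact: H.
  by rewrite !subrr normc0 normr0 mulr0.
apply: le_trans (normc_ReIm _) _; rewrite mulrDl mul1r /=; apply: lerD.
  apply: (mvt cos (fun u => - sin u)) => //; first exact: continuous_cos.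
  by move=> u; rewrite normrN (norm1 _ (cos u)) // addrC cos2Dsin2.
apply: (mvt sin cos) => //; first exact: continuous_sin.
by move=> u; rewrite (norm1 _ (sin u)) // cos2Dsin2.
Qed.

Lemma path_sum_big f n (gam : R -> C) t s :
  path_sum f n gam t s = \sum_(k < 2 ^ n)
    trapezoid f (gam (t + s * (k%:R / (2 ^ n)%:R)))
                (gam (t + s * (k.+1%:R / (2 ^ n)%:R))).
Proof.
elim: n t s => [|n IH] t s.
  by rewrite big_ord_recl big_ord0 /= addr0 !divr1 mulr0 mulr1 addr0.
rewrite [LHS]/= !IH (_ : (2 ^ n.+1)%N = (2 ^ n + 2 ^ n)%N); last first.
  by rewrite expnS mul2n addnn.
have N0 : (2 ^ n)%:R != 0 :> R by rewrite pnatr_eq0 expn_eq0.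
have NE : (2 ^ n + 2 ^ n)%:R = 2 * (2 ^ n)%:R :> R by rewrite natrD; ring.
rewrite big_split_ord /=; congr (_ + _); apply: eq_bigr => k _.
  by congr (trapezoid _ (gam _) (gam _)); rewrite NE; field.
congr (trapezoid _ (gam _) (gam _)); rewrite -?addnS NE natrD; by field.
Qed.

(** [N] times the mean of [z * f z] over the [N]-th roots of unity scaled by
    [r]. *)
Definition circle_sum f (r : R) N : C :=
  \sum_(k < N) f (r%:C * zeta R N ^+ k) * (r%:C * zeta R N ^+ k).

(** On a circle the trapezoid sums are multiples of arithmetic means: sum by
    parts, using that the points are in geometric progression. *)
Lemma path_sum_circle f n (r : R) :
  path_sum f n (fun v => r%:C * cis (pi *+ 2 * v)) 0 1 =
  (zeta R (2 ^ n) - conjc (zeta R (2 ^ n))) * circle_sum f r (2 ^ n).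
Proof.
set N := (2 ^ n)%N; have N0 : (0 < N)%N by rewrite expn_gt0.
pose w := zeta R N; pose z k : C := r%:C * w ^+ k.
have zE k : r%:C * cis (pi *+ 2 * (0 + 1 * (k%:R / N%:R))) = z k.
  by rewrite add0r mul1r /z -zetaX.
rewrite path_sum_big.
transitivity (\sum_(k < N) (f (z k) * z k * (w - 1) +
   f (z k.+1) * z k.+1 * (1 - conjc w))).
  apply: eq_bigr => k _; rewrite !zE /trapezoid.
  have e1 : z k.+1 - z k = z k * (w - 1) by rewrite /z exprSr; ring.
  have e2 : z k.+1 - z k = z k.+1 * (1 - conjc w).
    have -> : z k = z k.+1 * conjc w by rewrite /z exprSr -!mulrA cis_conj mulr1.
    by ring.
  by rewrite mulrDl {1}e1 e2 !mulrA.
rewrite big_split /= -!mulr_suml.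
have -> : \sum_(k < N) f (z k.+1) * z k.+1 = circle_sum f r N.
  have zN : z N = z 0%N by rewrite /z zeta_order // expr0.
  have : \sum_(k < N.+1) f (z k) * z k =
      f (z 0%N) * z 0%N + \sum_(k < N) f (z k.+1) * z k.+1.
    by rewrite big_ord_recl.
  by rewrite big_ord_recr zN [LHS]addrC => /addrI <-.
have -> : \sum_(k < N) f (z k) * z k = circle_sum f r N by [].
rewrite -/w; by ring.
Qed.

(** The multiple in [path_sum_circle] is at least of order [1 / N]: the powers of
    the square of [zeta] move from 1 to -1 in a quarter of [N] steps. *)
Lemma zeta_diff_lower n : (2 <= n)%N ->
  8 <= normc (zeta R (2 ^ n) - conjc (zeta R (2 ^ n))) * (2 ^ n)%:R.
Proof.
case: n => [|[|n]] // _; set N := (2 ^ n.+2)%N; pose w := zeta R N.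
have N0 : (0 < N)%N by rewrite expn_gt0.
have NE : N = (2 * (2 * 2 ^ n))%N by rewrite /N !expnS.
have wh : w ^+ (2 * 2 ^ n) = -1.
  have n0 : (0 < 2 * 2 ^ n)%N by rewrite muln_gt0 expn_gt0.
  have /eqP : (w ^+ (2 * 2 ^ n) - 1) * (w ^+ (2 * 2 ^ n) + 1) = 0.
    by rewrite -subr_sqr expr1n -exprM mulnC -NE zeta_order // subrr.
  rewrite mulf_eq0 subr_eq0 => /orP[|]; last by rewrite addr_eq0 => /eqP.
  by rewrite (negPf (@zeta_primitive R N _ n0 _)) // NE; lia.
have -> : w - conjc w = conjc w * (w ^+ 2 - 1).
  by rewrite mulrBr mulr1 expr2 mulrA [conjc w * w]mulrC cis_conj mul1r.
rewrite normcM normcJ normc_cis mul1r.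
have : normc ((w ^+ 2) ^+ (2 ^ n) - 1) <= normc (w ^+ 2 - 1) * (2 ^ n)%:R.
  rewrite subrX1 normcM ler_wpM2l ?normc_ge0 //.
  apply: le_trans (ler_normc_sum _ _ _) _.
  under eq_bigr do rewrite !normcX normc_cis !expr1n.
  by rewrite sumr_const card_ord.
rewrite -exprM wh -opprD normc_opp -[1 + 1]/(2%:R) -(rmorph_nat (real_complex R)).
rewrite normc_real ger0_norm // NE !natrM => H; lra.
Qed.

Lemma normc_nat n : normc (n%:R : C) = n%:R.
Proof. by rewrite -(rmorph_nat (real_complex R)) normc_real ger0_norm. Qed.

Lemma zeta_diff_average n (x : C) D : (2 <= n)%N ->
  normc ((zeta R (2 ^ n) - conjc (zeta R (2 ^ n))) * x) <= D ->
  normc ((2 ^ n)%:R^-1 * x) <= D / 8.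
Proof.
move=> n2; have := zeta_diff_lower n2; move: (zeta R _ - _) => w.
have N0 : 0 < (2 ^ n)%:R :> R by rewrite ltr0n expn_gt0.
rewrite !normcM normcV normc_nat ler_pdivrMl // => w8 wD; move: w8 wD.
move: (normc_ge0 x) N0; move: (normc w) (normc x) ((2 ^ n)%:R) => c b N.
move=> b0 N0 w8 wD; have := ler_wpM2l b0 w8; have := ler_wpM2l (ltW N0) wD.
lra.
Qed.

Lemma average_bound (F : nat -> C) n D : (forall k, normc (F k) <= D) ->
  normc ((2 ^ n)%:R^-1 * \sum_(k < 2 ^ n) F k) <= D.
Proof.
move=> FD; have N0 : 0 < (2 ^ n)%:R :> R by rewrite ltr0n expn_gt0.
rewrite normcM normcV normc_nat ler_pdivrMl //.
apply: le_trans (ler_normc_sum _ _ _) _.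
rewrite -[X in X%:R * _](card_ord (2 ^ n)) mulr_natl -sumr_const.
exact: ler_sum.
Qed.

Section MeanValue.
Variables (f : C -> C) (a : C) (r : R).
Hypothesis f_hol : forall z, normc z < 1 -> derivable f z 1.
Hypothesis ar : normc a < r.
Hypothesis r1 : r < 1.

Let a1 : normc a < 1 := lt_trans ar r1.
Let r0 : 0 < r := le_lt_trans (normc_ge0 a) ar.

(** The difference quotient at [a], with value 0 at [a] itself; it is bounded near
    [a], which is all that [goursat_bound] asks of an exceptional point. *)
Definition slope z : C := (f z - f a) / (z - a).

Let slope_diff z : normc z < 1 -> z != a -> exists d, diff_at slope z d.
Proof.
move=> z1 za; apply: derivable_diff_at.
apply: derivableM; first by apply: derivableB => //; exact: f_hol.
by apply: derivableV; [rewrite /= subr_eq0|apply: derivableB].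
Qed.

Let slope_bounded z : normc z < 1 -> exists M eta : R,
  [/\ 0 <= M, 0 < eta & forall w, normc (w - z) < eta -> normc (slope w) <= M].
Proof.
move=> z1; have [->|za] := eqVneq z a.
  have [d Hd] := derivable_diff_at (f_hol a1).
  have [eta eta0 H] := Hd 1 ltr01.
  exists (normc d + 1), eta; split=> //; first by rewrite addr_ge0 ?normc_ge0.
  move=> w /H; rewrite mul1r => fw; have [->|wa] := eqVneq w a.
    by rewrite /slope !subrr mul0r normc0 addr_ge0 ?normc_ge0.
  have w0 : 0 < normc (w - a) by rewrite normc_gt0 subr_eq0.
  rewrite /slope normcM normcV ler_pdivrMr // mulrDl mul1r -normcM.
  have := ler_normc_add (f w - (f a + d * (w - a))) (d * (w - a)).
  have -> : f w - (f a + d * (w - a)) + d * (w - a) = f w - f a by ring.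
  by move: fw; lra.
have [d Hd] := slope_diff z1 za.
have [eta eta0 H] := Hd 1 ltr01.
exists (normc (slope z) + (normc d + 1) * eta), eta; split=> //.
  by rewrite addr_ge0 ?normc_ge0 // mulr_ge0 ?addr_ge0 ?normc_ge0 // ltW.
move=> w wz; have := H w wz; rewrite mul1r => sw.
have := ler_normc_add (slope w - (slope z + d * (w - z))) (slope z + d * (w - z)).
rewrite subrK; have := ler_normc_add (slope z) (d * (w - z)).
have := ler_wpM2l (normc_ge0 d) (ltW wz).
by rewrite [normc (d * _)]normcM mulrDl mul1r; move: wz sw; lra.
Qed.

(* Polar coordinates on the annulus with radii [s] and [r]. *)
Let annulus (s x y : R) : C := (s + (r - s) * x)%:C * cis (pi *+ 2 * y).

Let annulus_lipschitz s : 0 < s -> s < r ->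
  forall u u' v v', 0 <= u <= 1 -> 0 <= u' <= 1 -> 0 <= v <= 1 -> 0 <= v' <= 1 ->
  normc (annulus s u v - annulus s u' v') <=
  (1 + pi *+ 2 * 2) * (`|u - u'| + `|v - v'|).
Proof.
move=> s0 sr u u' v v' /andP[u0 u1] /andP[u'0 u'1] _ _.
have pi0 : 0 < pi *+ 2 :> R by rewrite mulrn_wgt0 // pi_gt0.
pose c := cis (pi *+ 2 * v); pose c' := cis (pi *+ 2 * v').
have -> : annulus s u v - annulus s u' v' =
    ((r - s) * (u - u'))%:C * c + (s + (r - s) * u')%:C * (c - c').
  rewrite /annulus -/c -/c'.
  have -> : (s + (r - s) * u) = (r - s) * (u - u') + (s + (r - s) * u') by ring.
  by rewrite rmorphD /=; ring.
apply: le_trans (ler_normc_add _ _) _.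
rewrite !normcM !normc_real normc_cis mulr1 normrM (ger0_norm (_ : 0 <= r - s)); last lra.
rewrite (ger0_norm (_ : 0 <= s + (r - s) * u')); last first.
  by rewrite addr_ge0 ?(ltW s0) // mulr_ge0 //; lra.
have := cis_lipschitz (pi *+ 2 * v) (pi *+ 2 * v').
rewrite -mulrBr normrM (ger0_norm (ltW pi0)) -/c -/c'.
have h1 : 0 <= (r - s) * (1 - u') by apply: mulr_ge0; lra.
have h2 : 0 <= (r - s) * u' by apply: mulr_ge0; lra.
have rho1 : s + (r - s) * u' <= 1 by move: r1; lra.
have rho0 : 0 <= s + (r - s) * u' by lra.
have := normr_ge0 (u - u'); have := normr_ge0 (v - v').
have := normc_ge0 (c - c').
move: (pi *+ 2) pi0 (s + (r - s) * u') rho0 rho1 => q q0 rho rho0 rho1.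
move: (normc (c - c')) `|u - u'| `|v - v'| => x y z x0 z0 y0 H.
have : rho * x <= q * 2 * z.
  by apply: (@le_trans _ _ x); [rewrite ler_piMl|lra].
have : (r - s) * y <= y by rewrite ler_piMl //; move: r1; lra.
have : 0 <= q * y by rewrite mulr_ge0 // ltW.
by lra.
Qed.

Let annulus_norm s x y : 0 < s -> s < r -> 0 <= x <= 1 ->
  normc (annulus s x y) = s + (r - s) * x.
Proof.
move=> s0 sr /andP[x0 x1]; rewrite normcM normc_cis mulr1 normc_real ger0_norm //.
by rewrite addr_ge0 ?(ltW s0) // mulr_ge0 //; lra.
Qed.

Let cis_inj (x y : R) : `|x - y| <= 1 -> cis (pi *+ 2 * x) = cis (pi *+ 2 * y) ->
  x = y \/ x = y + 1 \/ x = y - 1.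
Proof.
have pi0 : 0 < pi *+ 2 :> R by rewrite mulrn_wgt0 // pi_gt0.
have key (u v : R) : u < v -> v - u <= 1 ->
    cis (pi *+ 2 * u) = cis (pi *+ 2 * v) -> v = u + 1.
  move=> uv; rewrite le_eqVlt => /orP[/eqP H _|H].
    by rewrite -H addrC subrK.
  have : cis (pi *+ 2 * v - pi *+ 2 * u) != 1.
    apply: cis_neq1; rewrite -mulrBr; first by rewrite mulr_gt0 // subr_gt0.
    by rewrite -[ltRHS]mulr1 ltr_pM2l.
  by rewrite cisD => + E; rewrite -E -cisD subrr cis0 eqxx.
rewrite ler_norml => /andP[d1 d2] E.
have [xy|yx|] := ltgtP x y; last by left.
- right; right; have := key x y xy _ E; rewrite lerBlDr => H.
  by rewrite H ?addrK //; lra.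
- by right; left; apply: key yx _ (esym E); lra.
Qed.

(** By Goursat's lemma on an annulus, the difference of the means over the circles
    of radii [r] and [s] tends to 0; the means over the small circle are at most
    a constant times [s]. *)
Lemma slope_average : tends (fun n =>
  (2 ^ n)%:R^-1 * circle_sum slope r (2 ^ n)) 0.
Proof.
move=> e e0.
have [M [eta [M0 eta0 HM]]] := @slope_bounded 0 (ltac:(rewrite normc0; exact: ltr01)).
have M1 : 0 < 2 * (M + 1) by lra.
pose s := Num.min (Num.min (eta / 2) (r / 2)) (e / (2 * (M + 1))).
have s0 : 0 < s by rewrite !lt_min !divr_gt0.
have s_eta : s < eta.
  by apply: (@le_lt_trans _ _ (eta / 2)); [rewrite !ge_min lexx|lra].
have sr : s < r.
  by apply: (@le_lt_trans _ _ (r / 2)); [rewrite !ge_min lexx orbT|move: r0; lra].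
have s_e : s * (2 * (M + 1)) <= e.
  by rewrite -ler_pdivlMr // ge_min lexx orbT.
have pi0 : 0 < pi *+ 2 :> R by rewrite mulrn_wgt0 // pi_gt0.
have L0 : 0 < 1 + pi *+ 2 * 2 :> R by lra.
have [x0 [y0 Hxy]] : exists x0 y0, forall x y, 0 <= x <= 1 -> 0 <= y <= 1 ->
    annulus s x y = a -> x = x0 /\ (y = y0 \/ y = y0 + 1 \/ y = y0 - 1).
  have [[x0 [y0 [x01 y01 E]]]|no] := pselect (exists x0 y0,
      [/\ 0 <= x0 <= 1, 0 <= y0 <= 1 & annulus s x0 y0 = a]).
    exists x0, y0 => x y x01' y01' E'.
    have xx : x = x0.
      have : normc (annulus s x y) = normc (annulus s x0 y0) by rewrite E E'.
      rewrite !annulus_norm // => /addrI /mulfI; apply.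
      by rewrite subr_eq0 gt_eqF.
    split=> //; apply: cis_inj.
      move/andP: y01 => [? ?]; move/andP: y01' => [? ?].
      by rewrite ler_norml; apply/andP; split; lra.
    move: E; rewrite -E' xx /annulus => /mulfI ->//.
    rewrite -normc_eq0 normc_real normr_eq0 gt_eqF //.
    move/andP: x01 => [? ?]; rewrite ltr_wpDr // mulr_ge0 //; lra.
  by exists 0, 0 => x y x01 y01 E; case: no; exists x, y.
have regular x y : 0 <= x <= 1 -> 0 <= y <= 1 ->
    (exists d, diff_at slope (annulus s x y) d) \/
    [/\ x = x0, (y = y0 \/ y = y0 + 1 \/ y = y0 - 1) &
     exists M eta : R, [/\ 0 <= M, 0 < eta &
       forall w, normc (w - annulus s x y) < eta -> normc (slope w) <= M]].
  move=> x01 y01.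
  have P1 : normc (annulus s x y) < 1.
    rewrite annulus_norm //; move/andP: x01 => [? ?].
    have h1 : 0 <= (r - s) * (1 - x) by apply: mulr_ge0; lra.
    by move: r1; lra.
  have [E|ne] := eqVneq (annulus s x y) a.
    right; have [xx yy] := Hxy x y x01 y01 E.
    by split=> //; apply: slope_bounded.
  by left; apply: slope_diff.
have e13 : 0 < e / 13 by rewrite divr_gt0.
have [N HN] := goursat_bound L0 (annulus_lipschitz s0 sr) regular e13.
exists (maxn N 2) => n; rewrite geq_max => /andP[Nn n2]; rewrite subr0.
have := HN n Nn; rewrite divfK ?pnatr_eq0 // /square_sum.
have per : (fun u => annulus s u (0 + 1)) = (fun u => annulus s u 0).
  apply/funext => u; rewrite /annulus add0r mulr1 mulr0; congr (_ * _).
  by rewrite /cis -[pi *+ 2]add0r cosD2pi sin0 add0r sin2pi.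
have outer : (fun v => annulus s (0 + 1) v) =
             (fun v => r%:C * cis (pi *+ 2 * v)).
  by apply/funext => v; rewrite /annulus add0r mulr1 addrC subrK.
have inner : (fun v => annulus s 0 v) = (fun v => s%:C * cis (pi *+ 2 * v)).
  by apply/funext => v; rewrite /annulus mulr0 addr0.
rewrite per outer inner !path_sum_circle.
rewrite [X in normc (X - _)]addrAC subrr add0r -mulrBr => /(zeta_diff_average n2).
rewrite mulrBr => close.
have inner_small : normc ((2 ^ n)%:R^-1 * circle_sum slope s (2 ^ n)) <= M * s.
  apply: (@average_bound (fun k => slope (s%:C * zeta R (2 ^ n) ^+ k) *
    (s%:C * zeta R (2 ^ n) ^+ k))) => k.
  have zs : normc (s%:C * zeta R (2 ^ n) ^+ k) = s.
    by rewrite normcM normc_zetaX mulr1 normc_real ger0_norm // ltW.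
  by rewrite normcM zs ler_pM2r // HM // subr0 zs.
have := ler_normc_add ((2 ^ n)%:R^-1 * circle_sum slope r (2 ^ n) -
  (2 ^ n)%:R^-1 * circle_sum slope s (2 ^ n))
  ((2 ^ n)%:R^-1 * circle_sum slope s (2 ^ n)).
rewrite subrK; nra.
Qed.

End MeanValue.
End Circle.

Section Cauchy.
Variable R : realType.
Local Notation C := R[i].
Variable f : C -> C.
Hypothesis f_hol : forall z, normc z < 1 -> derivable f z 1.
Hypothesis f_circle : forall r : R, 0 < r -> r < 1 ->
  exists M, forall z, normc z = r -> normc (f z) <= M.

Definition node (r : R) n k : C := r%:C * zeta R (2 ^ n) ^+ k.

Lemma normc_node r n k : 0 <= r -> normc (node r n k) = r.
Proof. by move=> r0; rewrite normcM normc_zetaX mulr1 normc_real ger0_norm. Qed.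

(** Discrete version of Cauchy's formula for the [m]-th Taylor coefficient. *)
Definition fourier r n m : C :=
  (2 ^ n)%:R^-1 * \sum_(k < 2 ^ n) f (node r n k) * (node r n k)^-1 ^+ m.

Lemma node_orthogonal r n m : 0 < r -> (m < 2 ^ n)%N ->
  (2 ^ n)%:R^-1 * \sum_(k < 2 ^ n) (node r n k)^-1 ^+ m = (m == 0%N)%:R.
Proof.
move=> r0 mn; have N0 : (2 ^ n)%:R != 0 :> C by rewrite pnatr_eq0 expn_eq0.
case: m mn => [|m] mn.
  under eq_bigr do rewrite expr0.
  by rewrite sumr_const card_ord mulVf.
pose w := zeta R (2 ^ n).
have w0 : w != 0 by rewrite -normc_gt0 normc_cis ltr01.
have -> : \sum_(k < 2 ^ n) (node r n k)^-1 ^+ m.+1 =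
    (r%:C)^-1 ^+ m.+1 * \sum_(k < 2 ^ n) (w^-1 ^+ m.+1) ^+ k.
  rewrite mulr_sumr; apply: eq_bigr => k _.
  by rewrite /node invfM exprMn; congr (_ * _); rewrite -exprVn -!exprM mulnC.
rewrite sum_root_of_unity ?mulr0 //.
  by rewrite -exprM mulnC exprM exprVn zeta_order ?expn_gt0 // invr1 expr1n.
by rewrite exprVn invr_eq1 zeta_primitive.
Qed.

(** Expand [z / (z - a)] as a geometric series in [a / z], with remainder, inside
    the mean of [z * slope z].  The mean of [f a] against the powers of [1 / z]
    is [f a], by [node_orthogonal]. *)
Lemma cauchy_error r a n L M : r < 1 -> normc a < r ->
  (forall z, normc z = r -> normc (f z) <= M) -> (L <= 2 ^ n)%N -> (0 < L)%N ->
  normc (\sum_(m < L) fourier r n m * a ^+ m - f a) <=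
  normc ((2 ^ n)%:R^-1 * circle_sum (slope f a) r (2 ^ n)) +
  (M + normc (f a)) * (normc a / r) ^+ L * (r / (r - normc a)).
Proof.
move=> r1 ar fM Ln L0.
have r0 : 0 < r := le_lt_trans (normc_ge0 a) ar.
pose t k : C := a / node r n k.
pose u k : C := f (node r n k) - f a.
have z0 k : node r n k != 0.
  by rewrite -normc_gt0 normc_node // ltW.
have za k : node r n k - a != 0.
  rewrite subr_eq0; apply: contraTneq ar => <-.
  by rewrite normc_node ?ltxx // ltW.
have t1 k : 1 - t k != 0.
  rewrite /t -(divff (z0 k)) -mulrBl mulf_neq0 ?invr_eq0 //.
have split k : slope f a (node r n k) * node r n k =
    \sum_(m < L) (u k * t k ^+ m) + u k * t k ^+ L / (1 - t k).
  rewrite -mulr_sumr -mulrA -mulrDr /slope -/(u k) -mulrA; congr (_ * _).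
  have -> : (node r n k - a)^-1 * node r n k = (1 - t k)^-1.
    by rewrite /t -[X in _ = (X - _)^-1](divff (z0 k)) -mulrBl invfM invrK.
  apply: (mulfI (t1 k)); rewrite divff // mulrDr mulrCA divff // mulr1.
  by rewrite -opprB mulNr -subrX1 opprB subrK.
have avgE : (2 ^ n)%:R^-1 * circle_sum (slope f a) r (2 ^ n) =
    (\sum_(m < L) fourier r n m * a ^+ m - f a) +
    (2 ^ n)%:R^-1 * \sum_(k < 2 ^ n) (u k * t k ^+ L / (1 - t k)).
  rewrite /circle_sum; under eq_bigr do rewrite -/(node r n _) split.
  rewrite big_split /= mulrDr; congr (_ + _).
  rewrite exchange_big /= mulr_sumr.
  have -> : f a = \sum_(m < L) f a * (m == 0%N :> nat)%:R * a ^+ m.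
    rewrite (bigD1 (Ordinal L0)) //= !mulr1 big1 ?addr0 // => i i0.
    by rewrite (negPf (_ : (i : nat) != 0%N)) ?mulr0 ?mul0r //.
  rewrite -sumrB; apply: eq_bigr => m _; rewrite -mulrBl.
  rewrite -(node_orthogonal r0 (leq_trans (ltn_ord m) Ln)) /fourier.
  rewrite mulrCA -mulrBr -mulrA; congr (_ * _).
  rewrite mulr_sumr -sumrB mulr_suml; apply: eq_bigr => k _.
  by rewrite /u /t exprMn; ring.
have rem k : normc (u k * t k ^+ L / (1 - t k)) <=
    (M + normc (f a)) * (normc a / r) ^+ L * (r / (r - normc a)).
  have nt : normc (t k) = normc a / r.
    by rewrite normcM normcV normc_node // ltW.
  have ra : 0 < r - normc a by rewrite subr_gt0.
  rewrite !normcM normcX nt normcV; apply: ler_pM.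
  - by rewrite mulr_ge0 ?normc_ge0 // exprn_ge0 // divr_ge0 ?normc_ge0 // ltW.
  - by rewrite invr_ge0 normc_ge0.
  - rewrite ler_wpM2r ?exprn_ge0 ?divr_ge0 ?normc_ge0 ?(ltW r0) //.
    apply: le_trans (ler_normc_sub _ _) _; rewrite lerD2r fM //.
    by rewrite normc_node // ltW.
  - rewrite -[leRHS]invrK lef_pV2 ?posrE ?normc_gt0 ?invr_gt0 ?divr_gt0 //.
    rewrite invf_div mulrBl divff ?gt_eqF // -nt.
    have := ler_normc_add (1 - t k) (t k); rewrite subrK normc1.
    by lra.
have := average_bound n rem.
have := ler_normc_sub ((2 ^ n)%:R^-1 * circle_sum (slope f a) r (2 ^ n))
  ((2 ^ n)%:R^-1 * \sum_(k < 2 ^ n) (u k * t k ^+ L / (1 - t k))).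
by rewrite {1}avgE addrK; lra.
Qed.

Lemma local_power_series (r : R) : 0 < r -> r < 1 ->
  exists c : fps C, forall a, normc a < r -> tends (psum c a) (f a).
Proof.
move=> r0 r1; have [M fM] := f_circle r0 r1.
have M0 : 0 <= M.
  apply: le_trans (normc_ge0 (f r%:C)) (fM _ _).
  by rewrite normc_real ger0_norm // ltW.
have [U [U_ultra leU]] := ultraFilterLemma eventually_filter.
have Uf : ProperFilter U by exact: ultra_proper.
have bounded m n : normc (fourier r n m) <= M * r^-1 ^+ m.
  apply: (@average_bound R (fun k => f (node r n k) * (node r n k)^-1 ^+ m)) => k.
  rewrite normcM normcX normcV normc_node ?(ltW r0) //.
  rewrite ler_wpM2r ?exprn_ge0 ?invr_ge0 ?(ltW r0) // fM //.
  by rewrite normc_node // ltW.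
have [c Hc] : exists c : nat -> C, forall m, forall e : R, 0 < e ->
    U [set n | normc (fourier r n m - c m) < e].
  have H m := complex_ultralimit U_ultra (bounded m).
  by exists (fun m => projT1 (cid (H m))) => m; case: cid.
exists (FPS c) => a ar e e0.
pose D := (M + normc (f a)) * (r / (r - normc a)) + 1.
have q0 : 0 <= normc a / r by rewrite divr_ge0 ?normc_ge0 // ltW.
have q1 : normc a / r < 1 by rewrite ltr_pdivrMr // mul1r.
have D0 : 0 < D.
  rewrite /D ltr_wpDl // !mulr_ge0 ?addr_ge0 ?normc_ge0 ?(ltW r0) //.
  by rewrite invr_ge0 subr_ge0 ltW.
have e4 : 0 < e / 4 by rewrite divr_gt0.
have [L0 HL] := expr_small q0 q1 (divr_gt0 e4 D0).
exists L0.+1 => L LL0.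
have L_gt0 : (0 < L)%N by apply: leq_trans LL0.
have [N HN] := slope_average f_hol ar r1 e4.
have Hca m (d : R) : 0 < d ->
    U [set n | normc (fourier r n m * a ^+ m - c m * a ^+ m) < d].
  move=> d0; have D1 : 0 < normc (a ^+ m) + 1.
    by rewrite ltr_wpDl ?normc_ge0.
  apply: filterS (Hc m _ (divr_gt0 d0 D1)) => n /=.
  rewrite ltr_pdivlMr // => H; rewrite -mulrBl normcM.
  apply: le_lt_trans H; rewrite ler_wpM2l ?normc_ge0 // lerDl //.
have Usum := ultralimit_sum U_ultra L Hca e4.
have Uev : U [set n | (maxn N L <= n)%N].
  by apply: leU; exists (maxn N L).
have [n [/= n1 n2]] := filter_ex (filterI Usum Uev).
have nN : (N <= n)%N := leq_trans (leq_maxl _ _) n2.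
have Ln : (L <= 2 ^ n)%N.
  by apply: leq_trans (leq_trans (leq_maxr N L) n2) (ltnW (ltn_expl n _)).
have err := cauchy_error r1 ar fM Ln L_gt0.
have := HN n nN; rewrite subr0 => slope_small.
have tail : (M + normc (f a)) * (normc a / r) ^+ L * (r / (r - normc a)) < e / 4.
  rewrite mulrAC; have := HL L (ltnW LL0); rewrite ltr_pdivlMr // mulrC => H.
  apply: le_lt_trans H; rewrite ler_wpM2r ?exprn_ge0 // /D lerDl //.
set S := \sum_(m < L) fourier r n m * a ^+ m in n1 err.
have n1' : normc (psum (FPS c) a L - S) < e / 4 by rewrite normc_distC.
by have := ler_normc_dist (psum (FPS c) a L) S (f a); lra.
Qed.

(** The series found on different circles agree near 0, hence everywhere. *)
Theorem holomorphic_power_series : exists c : fps C, evals c f.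
Proof.
have half1 : (1 / 2 : R) < 1 by lra.
have half0 : 0 < (1 / 2 : R) by lra.
have [c Hc] := local_power_series half0 half1.
exists c => z z1; pose r := Num.max (1 / 2) ((normc z + 1) / 2).
have r0 : 0 < r by rewrite lt_max half0.
have r1 : r < 1 by rewrite gt_max half1 /=; lra.
have zr : normc z < r by rewrite lt_max; apply/orP; right; lra.
have [c' Hc'] := local_power_series r0 r1.
have -> : c = c'; last exact: Hc'.
apply: (psum_unique half0 Hc) => w w2; apply: Hc'.
by rewrite lt_max w2.
Qed.

End Cauchy.

(** * Boundedness of the commuting operator *)

Section Growth.
Variable R : realType.
Local Notation C := R[i].
Implicit Types (a b g : fps C) (f F : C -> C).

Lemma wnorm_fcomp (r : R) M g a : 0 <= r -> g 0%N = 0 ->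
  wnorm r M (fcomp g a) <= wnorm (wnorm r M g) M a.
Proof.
move=> r0 g0.
apply: (@le_trans _ _ (\sum_(n < M) \sum_(j < M)
    normc (a j) * (normc ((g ^+ j) n) * r ^+ n))).
  apply: ler_sum => n _; rewrite (@fcompE _ _ g0 M) //.
  under [leRHS]eq_bigr do rewrite mulrA.
  rewrite -mulr_suml ler_wpM2r ?exprn_ge0 //.
  apply: le_trans (ler_normc_sum _ _ _) _.
  by apply: ler_sum => j _; rewrite normcM.
rewrite exchange_big; apply: ler_sum => j _; rewrite -mulr_sumr.
by rewrite ler_wpM2l ?normc_ge0 //; exact: wnormX.
Qed.

Lemma l2Z M (c : C) a : l2 M (fC c * a) = normc c ^+ 2 * l2 M a.
Proof.
by rewrite /l2 mulr_sumr; apply: eq_bigr => n _; rewrite fCME normcM exprMn.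
Qed.

Lemma l2_one M : l2 M (1 : fps C) <= 1.
Proof.
case: M => [|M]; first by rewrite /l2 big_ord0.
rewrite /l2 big_ord_recl fps1E eqxx normc1 expr1n big1 ?addr0 // => i _.
by rewrite (_ : (1 : fps C) _ = 0) ?normc0 ?expr0n // fps1E lift0.
Qed.

(** The Hardy norm is at most the supremum norm: apply
    [multiplication_contraction] to the constant 1. *)
Lemma l2_sup a F D : evals a F -> 0 < D ->
  (forall z, normc z < 1 -> normc (F z) <= D) -> forall M, l2 M a <= D ^+ 2.
Proof.
move=> aF D0 FD M; pose c : C := (D^-1)%:C.
have nc : normc c = D^-1 by rewrite normc_real ger0_norm // invr_ge0 ltW.
have cF : evals (fC c * a) (fun z => c * F z) := evalsM (evalsC c) aF.
have cF1 z : normc z < 1 -> normc (c * F z) <= 1.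
  by move=> z1; rewrite normcM nc ler_pdivrMl // mulr1 FD.
have := multiplication_contraction cF cF1 M 1.
rewrite mulr1 l2Z nc => H.
have := le_trans H (l2_one M).
by rewrite exprVn ler_pdivrMl ?exprn_gt0 // mulr1.
Qed.

Lemma evals_sum N (c : nat -> C) (b : nat -> fps C) (F : nat -> C -> C) :
  (forall k, evals (b k) (F k)) ->
  evals (\sum_(k < N) fC (c k) * b k) (fun z => \sum_(k < N) c k * F k z).
Proof.
move=> bF; elim: N => [|N IH] z z1.
  by rewrite !big_ord0; have := evalsC 0 z1; rewrite rmorph0.
rewrite !big_ord_recr.
exact: (evalsD IH (evalsM (evalsC (c N)) (bF N)) z1).
Qed.

Variables (phi psi : fps C) (f : C -> C) (lambda : C) (p : nat).
Hypothesis phif : evals phi f.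
Hypothesis f_lt1 : forall z, normc z < 1 -> normc (f z) < 1.
Hypothesis p_ge2 : (2 <= p)%N.
Hypothesis lambda0 : lambda != 0.
Hypothesis psi0 : psi 0%N = 1.
Hypothesis phiE : phi = fX ^+ p * (fC lambda * psi).

Let p_gt0 : (0 < p)%N. Proof. exact: ltnW. Qed.

Lemma phi_vanish : vanish p phi.
Proof. by apply/vanishP; exists (fC lambda * psi). Qed.

Let phi0 : phi 0%N = 0. Proof. exact: phi_vanish. Qed.

Let f_le1 z : normc z < 1 -> normc (f z) <= 1.
Proof. by move=> /f_lt1/ltW. Qed.

Lemma phi_powers_coef j n : normc ((phi ^+ j) n) <= 1.
Proof.
rewrite -(@ler_pXn2r _ 2) ?nnegrE ?normc_ge0 //.
apply: le_trans (l2_coef _ _) _.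
apply: (l2_sup (evalsX j phif) ltr01) => z /f_le1 fz.
by rewrite normcX exprn_ile1 ?normc_ge0.
Qed.

(** Schwarz's lemma by the power trick: all powers of [f] have coefficients
    bounded by 1, so the [j]-th power is at most [r ^+ (p * j) / (1 - r)];
    compare [j]-th roots as [j] grows. *)
Lemma schwarz z : normc z < 1 -> normc (f z) <= normc z ^+ p.
Proof.
move=> z1; set r := normc z; have r0 : 0 <= r := normc_ge0 z.
have r1 : 0 < 1 - r by rewrite subr_gt0.
have key j : normc (f z) ^+ j <= (r ^+ p) ^+ j / (1 - r).
  rewrite -normcX -[f z ^+ j]subr0.
  apply: (tends_le (evalsX j phif z1)); exists (p * j)%N => N pN.
  rewrite subr0; have [k ->] : exists k, N = (p * j + k)%N.
    by exists (N - p * j)%N; rewrite subnKC.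
  apply: le_trans (wnorm_psum _ _ _) _.
  rewrite /wnorm big_split_ord /= big1 ?add0r => [|i _]; last first.
    by rewrite (vanishX phi_vanish) ?normc0 ?mul0r.
  apply: le_trans (ler_wpM2l _ (geometric_bound k r0 z1)); last first.
    by rewrite !exprn_ge0.
  rewrite mulr_sumr; apply: ler_sum => i _.
  rewrite -exprM -exprD ler_piMl ?exprn_ge0 //; exact: phi_powers_coef.
rewrite leNgt; apply/negP => lt_f.
have f0 : 0 < normc (f z) by apply: le_lt_trans lt_f; exact: exprn_ge0.
have q0 : 0 <= r ^+ p / normc (f z) by rewrite divr_ge0 ?exprn_ge0 ?normc_ge0.
have q1 : r ^+ p / normc (f z) < 1 by rewrite ltr_pdivrMr // mul1r.
have [j Hj] := expr_small q0 q1 r1.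
have := Hj j (leqnn j); rewrite expr_div_n ltr_pdivrMr ?exprn_gt0 //.
by have := key j; rewrite ler_pdivlMr // mulrC; lra.
Qed.

(* The inverse of [psi], as a Neumann series. *)
Let inv_psi : fps C := fcomp (1 - psi) (FPS (fun=> 1)).

Let opp_psi0 : (1 - psi) 0%N = 0.
Proof. by rewrite fpsBE fps1E psi0 subrr. Qed.

Let psi_inv : psi * inv_psi = 1.
Proof.
have geo : (1 - fX) * FPS (fun=> 1) = 1 :> fps C.
  apply: fpsP => n; rewrite mulrBl mul1r fpsBE -[fX]expr1 fXnME fps1E.
  by case: n => [|n] /=; rewrite ?subr0 ?subrr.
have := congr1 (fcomp (1 - psi)) geo.
rewrite (fcompM opp_psi0) fcompD fcompN (fcompX opp_psi0) fcomp1.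
by rewrite opprB addrC subrK.
Qed.

Definition inv_phi : fps C := fC lambda^-1 * inv_psi.

Lemma phi_inv : phi * inv_phi = fX ^+ p.
Proof.
rewrite phiE /inv_phi.
have -> : fX ^+ p * (fC lambda * psi) * (fC lambda^-1 * inv_psi) =
  fX ^+ p * ((fC lambda * fC lambda^-1) * (psi * inv_psi)) by ring.
by rewrite psi_inv -rmorphM divff // rmorph1 !mulr1.
Qed.

Let psi_coef n : normc (psi n) <= (normc lambda)^-1.
Proof.
have l0 : 0 < normc lambda by rewrite normc_gt0.
rewrite -[leRHS]mul1r ler_pdivlMr // mulrC -normcM.
have -> : lambda * psi n = phi (n + p)%N.
  by rewrite phiE fXnME; case: ltnP => [|_]; [lia|rewrite addnK fCME].
by have := phi_powers_coef 1 (n + p); rewrite expr1.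
Qed.

(* A radius at which [phi] maps the weighted l1 ball into itself and [1 - psi] has
   norm at most 1/2. *)
Let rho : R := Num.min (1 / 2) (normc lambda / 4).

Let rho_gt0 : 0 < rho.
Proof. by rewrite lt_min !divr_gt0 // normc_gt0. Qed.

Let rho_half : rho <= 1 / 2.
Proof. by rewrite ge_min lexx. Qed.

Let rho_geometric (A : R) d a M : 0 <= A -> vanish d a ->
  (forall n, normc (a n) <= A) -> wnorm rho M a <= A * rho ^+ d * 2.
Proof.
move=> A0 ad aA; apply: le_trans (wnorm_homo a (ltW rho_gt0) (leq_addl d M)) _ => /=.
rewrite /wnorm big_split_ord /= big1 ?add0r => [|i _]; last first.
  by rewrite ad ?normc0 ?mul0r.
apply: (@le_trans _ _ (A * rho ^+ d * \sum_(i < M) rho ^+ i)).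
  rewrite mulr_sumr; apply: ler_sum => i _.
  by rewrite -mulrA -exprD ler_wpM2r ?exprn_ge0 // ltW.
rewrite ler_wpM2l ?mulr_ge0 ?exprn_ge0 ?(ltW rho_gt0) //.
have rho1 : rho < 1 by move: rho_half; lra.
apply: le_trans (geometric_bound M (ltW rho_gt0) rho1) _.
by rewrite invf_ple ?posrE ?subr_gt0 //; move: rho_half; lra.
Qed.

Let phi_wnorm M : wnorm rho M phi <= rho.
Proof.
have v2 : vanish 2 phi by move=> n n2; apply: phi_vanish; exact: leq_trans p_ge2.
have c1 n : normc (phi n) <= 1 by have := phi_powers_coef 1 n; rewrite expr1.
apply: le_trans (rho_geometric M ler01 v2 c1) _.
by rewrite mul1r expr2; move: rho_half rho_gt0 => h g; nra.
Qed.

Let wnorm_fcomp_phi M a : wnorm rho M (fcomp phi a) <= wnorm rho M a.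
Proof.
apply: le_trans (wnorm_fcomp M a (ltW rho_gt0) phi0) _.
apply: ler_sum => n _; rewrite ler_wpM2l ?normc_ge0 //.
by apply: lerXn2r; rewrite ?nnegrE ?wnorm_ge0 ?(ltW rho_gt0).
Qed.

Let inv_phi_wnorm M : wnorm rho M inv_phi <= 2 / normc lambda.
Proof.
have l0 : 0 < normc lambda by rewrite normc_gt0.
have il0 : 0 <= (normc lambda)^-1 by rewrite invr_ge0 ltW.
set t := wnorm rho M (1 - psi).
have t_half : t <= 1 / 2.
  apply: (@le_trans _ _ ((normc lambda)^-1 * rho ^+ 1 * 2)).
    apply: rho_geometric => // [[|//] _|n]; first exact: opp_psi0.
    rewrite fpsBE fps1E; case: n => [|n]; first by rewrite psi0 subrr normc0.
    by rewrite sub0r normc_opp.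
  rewrite expr1 -mulrA mulrC ler_pdivrMr //.
  have : rho <= normc lambda / 4 by rewrite ge_min lexx orbT.
  by lra.
have t0 : 0 <= t by rewrite wnorm_ge0 // ltW.
apply: (@le_trans _ _ ((normc lambda)^-1 * wnorm rho M inv_psi)).
  rewrite /wnorm mulr_sumr; apply: ler_sum => n _.
  by rewrite fCME normcM normcV mulrA.
rewrite mulrC ler_wpM2r //.
apply: le_trans (wnorm_fcomp _ _ (ltW rho_gt0) opp_psi0) _; rewrite -/t.
apply: (@le_trans _ _ (\sum_(n < M) t ^+ n)).
  by apply: ler_sum => n _; rewrite [X in normc X](_ : _ = 1) // normc1 mul1r.
have t1 : t < 1 by lra.
apply: le_trans (geometric_bound M t0 t1) _.
by rewrite invf_ple ?posrE ?subr_gt0 //; lra.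
Qed.

Let Lam : R := 2 / normc lambda + 1.

Let Lam_ge1 : 1 <= Lam.
Proof. by rewrite lerDr divr_ge0 ?normc_ge0. Qed.

Let Lam_ge0 : 0 <= Lam. Proof. exact: le_trans Lam_ge1. Qed.

(* The recursion of [cofactor] squares the bound, while [p ^ k] at least
   doubles. *)
Let cofactor_wnorm k M : wnorm rho M (cofactor phi inv_phi p k) <= Lam ^+ (p ^ k).
Proof.
elim: k => [|k IH].
  by apply: le_trans (wnorm1 _ _) _; rewrite expn0 expr1.
rewrite cofactorS; apply: le_trans (wnormM _ _ _ (ltW rho_gt0)) _.
apply: (@le_trans _ _ (Lam ^+ (p ^ k) * Lam ^+ (p ^ k))).
  apply: ler_pM; rewrite ?wnorm_ge0 ?(ltW rho_gt0) //.
    apply: le_trans (wnormX _ _ _ (ltW rho_gt0)) _.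
    rewrite ler_pXn2r ?nnegrE ?wnorm_ge0 ?(ltW rho_gt0) ?expn_gt0 ?p_gt0 //.
    by apply: le_trans (inv_phi_wnorm M) _; rewrite lerDl.
  exact: le_trans (wnorm_fcomp_phi _ _) IH.
rewrite -exprD ler_weXn2l // addnn -mul2n expnS leq_mul2r.
by rewrite p_ge2 orbT.
Qed.

Definition coord_growth : R := Lam / rho.

Lemma coord_growth_gt0 : 0 < coord_growth.
Proof. by rewrite divr_gt0 // (lt_le_trans ltr01). Qed.

(** The factor [p ^ k] lost to the derivative is compensated by the normalisation
    of [coord]. *)
Lemma coord_bound k a B : 0 <= B -> (forall M, l2 M a <= B ^+ 2) ->
  normc (coord phi inv_phi p k a) <= B * coord_growth ^+ (p ^ k).
Proof.
move=> B0 aB; have P0 : (0 < p ^ k)%N by rewrite expn_gt0 p_gt0.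
have aB1 n : normc (a n) <= B.
  rewrite -(@ler_pXn2r _ 2) ?nnegrE ?normc_ge0 //.
  exact: le_trans (l2_coef _ _) (aB _).
set W := cofactor phi inv_phi p k; set N := (p ^ k)%N.
have N0 : 0 < N%:R :> R by rewrite ltr0n.
rewrite /coord normcM normcV normc_nat -/N -/W ler_pdivrMl //.
apply: (@le_trans _ _ (\sum_(i < N) N%:R * B * normc (W (N.-1 - i)%N))).
  rewrite fpsME; apply: le_trans (ler_normc_sum _ _ _) _.
  rewrite prednK //; apply: ler_sum => i _; rewrite normcM.
  rewrite ler_wpM2r ?normc_ge0 // -[fD a i]/(a i.+1 *+ i.+1).
  rewrite -[a i.+1 *+ _]mulr_natl normcM normc_nat.
  by apply: ler_pM; rewrite ?normc_ge0 ?ler0n // ler_nat.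
rewrite -mulr_sumr -mulrA ler_wpM2l ?ler0n // ler_wpM2l //.
have -> : \sum_(i < N) normc (W (N.-1 - i)%N) = \sum_(i < N) normc (W i).
  rewrite [RHS](reindex_inj rev_ord_inj) /=; apply: eq_bigr => i _.
  by rewrite subnS; congr (normc (W _)); lia.
rewrite /coord_growth expr_div_n ler_pdivlMr ?exprn_gt0 //.
apply: le_trans (cofactor_wnorm k N); rewrite mulr_suml; apply: ler_sum => i _.
rewrite ler_wpM2l ?normc_ge0 // ler_wiXn2l ?(ltW rho_gt0) //; last exact: ltnW.
by move: rho_half; lra.
Qed.

Lemma l2_phi_iter k M : l2 M (phi_iter phi k) <= 1.
Proof.
elim: k M => [|k IH] M.
  rewrite -[leRHS](expr1n _ 2).
  apply: (l2_sup (evals_poly 'X) ltr01) => z z1.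
  by rewrite hornerX ltW.
rewrite phi_iterS; exact: le_trans (littlewood phif f_le1 M _ phi0) (IH M).
Qed.

Lemma evals_phi_iter k : evals (phi_iter phi k) (iter k f).
Proof.
elim: k => [|k IH] z z1.
  by have := evals_poly 'X z1; rewrite hornerX.
rewrite phi_iterS iterSr.
exact: (evals_fcomp phif f_le1 f_lt1 phi0 (l2_phi_iter k) IH z1).
Qed.

Variables (n0 : nat) (s : R).
Hypothesis s1 : s < 1.
Hypothesis iter_le : forall z, normc z < 1 -> normc (iter n0 f z) <= s.

Let s0 : 0 <= s.
Proof.
by apply: le_trans (normc_ge0 _) (@iter_le 0 _); rewrite normc0 ltr01.
Qed.

Let iter_disc k z : normc z < 1 -> normc (iter k f z) < 1.
Proof. by move=> z1; elim: k => //= k; exact: f_lt1. Qed.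

Let iter_decay i z : normc z < 1 -> normc (iter (i + n0) f z) <= s ^+ (p ^ i).
Proof.
move=> z1; elim: i => [|i IH]; first by rewrite expr1 iter_le.
rewrite addSn iterS; apply: le_trans (schwarz (iter_disc _ z1)) _.
by rewrite expnSr exprM ler_pXn2r ?nnegrE ?normc_ge0 ?exprn_ge0.
Qed.

(** [coord k] may grow like [K ^+ (p ^ k)], but the iterates of [f] decay like
    [t ^+ (p ^ k)] for some [t < 1], by [schwarz] and the hypothesis on one
    iterate.  A large power [m] of them wins; one more than a power of [p] is
    itself not a power of [p]. *)
Lemma twist_bounded : exists (m : nat) (D : R),
  [/\ (0 < m)%N, forall k, (p ^ k)%N != m, 0 < D &
   forall a B, 0 < B -> (forall M, l2 M a <= B ^+ 2) ->
     forall M, l2 M (twist phi inv_phi p m a) <= (B * D) ^+ 2].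
Proof.
have K0 := coord_growth_gt0; set K := coord_growth in K0.
have [m' Hm'] := expr_small s0 s1 (divr_gt0 (ltr0n R 1 : 0 < 1) (mulr_gt0 (ltr0n R 2) K0)).
pose m := (p ^ (n0 + m').+1).+1.
have m_ge : (p ^ n0 * m' <= m)%N.
  rewrite /m expnS expnD leqW //.
  apply: (@leq_trans (p ^ n0 * p ^ m')); last by rewrite leq_pmull.
  by rewrite leq_mul2l (ltnW (ltn_expl m' p_ge2)) orbT.
pose D : R := \sum_(k < n0) K ^+ (p ^ k) + 2.
have D0 : 0 < D.
  by rewrite ltr_wpDl // sumr_ge0 // => k _; rewrite exprn_ge0 // ltW.
exists m, D; split=> // [k|a B B0 aB M].
  have [kN|Nk] := leqP k (n0 + m').+1.
    by rewrite neq_ltn ltnS leq_pexp2l.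
  rewrite neq_ltn orbC /m; apply/orP; left.
  apply: (@leq_trans (p ^ (n0 + m').+2)); last by rewrite leq_pexp2l.
  rewrite [(p ^ (n0 + m').+2)%N]expnS.
  have : (2 <= p ^ (n0 + m').+1)%N.
    by rewrite expnS (leq_trans p_ge2) // leq_pmulr // expn_gt0 p_gt0.
  move: (p ^ _)%N => x x2.
  apply: leq_trans (leq_mul p_ge2 (leqnn x)).
  by rewrite mul2n -addnn -[x.+1]add1n ltn_add2r.
pose c k := coord phi inv_phi p k a.
pose S := \sum_(k < M) fC (c k) * phi_iter phi k ^+ m.
have -> : l2 M (twist phi inv_phi p m a) = l2 M S.
  apply: eq_bigr => n _; rewrite (twistE _ p_ge2 phi_vanish _ _ (ltn_ord n)) //.
  rewrite /S fps_sumE; congr (normc _ ^+ 2).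
  by apply: eq_bigr => k _; rewrite fCME.
have SE : evals S (fun z => \sum_(k < M) c k * iter k f z ^+ m).
  apply: (@evals_sum M c (fun k => phi_iter phi k ^+ m)
    (fun k z => iter k f z ^+ m)) => k.
  exact/evalsX/evals_phi_iter.
apply: (l2_sup SE); first by rewrite mulr_gt0.
move=> z z1; apply: le_trans (ler_normc_sum _ _ _) _.
have termE k : normc (c k * iter k f z ^+ m) <= B * (if (k < n0)%N then
    K ^+ (p ^ k) else 2^-1 ^+ k).
  have ck : normc (c k) <= B * K ^+ (p ^ k) by apply: coord_bound => //; exact: ltW.
  rewrite normcM normcX; have Kk : 0 <= K ^+ (p ^ k) by rewrite exprn_ge0 // ltW.
  case: ltnP => [_|n0k].
    apply: le_trans ck; rewrite ler_piMr ?normc_ge0 //.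
    by rewrite exprn_ile1 ?normc_ge0 // ltW // iter_disc.
  apply: (@le_trans _ _ (B * K ^+ (p ^ k) * s ^+ (m' * p ^ k))).
    apply: ler_pM; rewrite ?normc_ge0 ?exprn_ge0 ?normc_ge0 //.
    have -> : k = (k - n0 + n0)%N by rewrite subnK.
    apply: (@le_trans _ _ ((s ^+ (p ^ (k - n0))) ^+ m)).
      by rewrite ler_pXn2r ?nnegrE ?normc_ge0 ?exprn_ge0 // iter_decay.
    rewrite -exprM ler_wiXn2l ?(ltW s1) // expnD.
    rewrite mulnC -mulnA leq_mul2l mulnC; apply/orP; right.
    by rewrite mulnC; move: m_ge; rewrite mulnC.
  rewrite -mulrA ler_pM2l // exprM -exprMn.
  apply: (@le_trans _ _ (2^-1 ^+ (p ^ k))).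
    have Ks0 : 0 <= K * s ^+ m' := mulr_ge0 (ltW K0) (exprn_ge0 _ s0).
    apply: lerXn2r; rewrite ?nnegrE // ?invr_ge0 //.
    have := ltW (Hm' m' (leqnn m')); rewrite ler_pdivlMr; last first.
      exact: mulr_gt0.
    by lra.
  rewrite ler_wiXn2l ?invr_ge0 //; first by lra.
  by rewrite ltnW // ltn_expl.
apply: (@le_trans _ _ (B * \sum_(k < M) (if (k < n0)%N then
    K ^+ (p ^ k) else 2^-1 ^+ k))).
  by rewrite mulr_sumr; apply: ler_sum => k _.
rewrite ler_pM2l //.
pose u k : R := if (k < n0)%N then K ^+ (p ^ k) else 2^-1 ^+ k.
have u0 k : 0 <= u k by rewrite /u; case: ifP => _; rewrite exprn_ge0 // ?invr_ge0 ?(ltW K0).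
apply: (@le_trans _ _ (\sum_(k < n0 + M) u k)).
  by rewrite addnC big_split_ord /= lerDl sumr_ge0.
rewrite big_split_ord /= /D; apply: lerD.
  by apply: ler_sum => k _; rewrite /u ltn_ord.
apply: (@le_trans _ _ (\sum_(k < M) 2^-1 ^+ k)).
  apply: ler_sum => k _; rewrite /u ltnNge leq_addr /=.
  by rewrite ler_wiXn2l ?invr_ge0 ?leq_addl //; lra.
have h0 : 0 <= 2^-1 :> R by rewrite invr_ge0.
have h1 : 2^-1 < 1 :> R by lra.
apply: le_trans (geometric_bound M h0 h1) _.
by rewrite invf_ple ?posrE ?subr_gt0 //; lra.
Qed.

End Growth.

(** * Operators on the Hardy space *)

Section WeakOperatorTopology.
Variable R : realType.
Local Notation C := R[i].
Variables (V : lmodType C) (ip : V -> V -> C).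

Lemma matrix_coefficient_continuous (u v : V) :
  continuous (fun T : weak_operator_topology ip =>
    ip ((T : bounded_operator ip) u) v).
Proof.
move=> T; pose F := (fun T : bounded_operator ip =>
  (fun uv => ip (T uv.1) uv.2) : {ptws V * V -> C}).
apply: (@continuous_comp (weak_operator_topology ip) {ptws V * V -> C} C F
  (fun h => h (u, v))).
  exact: (@initial_continuous _ _ F).
exact: (@proj_continuous _ (fun=> C) (u, v)).
Qed.

(** Matrix coefficients are continuous for the weak operator topology, so their
    zero sets are closed. *)
Lemma closure_matrix_coefficient0 (S : set (bounded_operator ip)) (u v : V) :
  (forall T, S T -> ip (T u) v = 0) ->
  forall T, closure (S : set (weak_operator_topology ip)) T -> ip (T u) v = 0.
Proof.
move=> S0 T clT.
have Sz : (S : set (weak_operator_topology ip)) `<=`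
    (fun T : weak_operator_topology ip => ip ((T : bounded_operator ip) u) v) @^-1`
    [set 0].
  by move=> T' /S0.
have := closure_subset Sz clT; rewrite -(closure_id _).1 //.
apply: closed_comp; first by move=> T' _; exact: matrix_coefficient_continuous.
exact/accessible_closed_set1/hausdorff_accessible/norm_hausdorff.
Qed.

End WeakOperatorTopology.

Section HardyOperators.
Variable R : realType.
Local Notation C := R[i].
Implicit Types (f g : H2 R) (a : fps C).

Definition hcoef f : fps C := FPS (taylor_coef f).

Lemma evals_hcoef f : evals (hcoef f) f.
Proof.
apply/evals_taylor; rewrite /hcoef /= /taylor_coef.
by case: cid => b [].
Qed.

Lemma summable_hcoef f : square_summable (hcoef f).
Proof. by rewrite /hcoef /= /taylor_coef; case: cid => b []. Qed.

Lemma l2_series a : (fun M => l2 M a) = series (fun n => normc (a n) ^+ 2).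
Proof. by apply/funext => M; rewrite /series /= big_mkord. Qed.

Lemma summable_l2 a B : (forall M, l2 M a <= B) -> square_summable a.
Proof.
move=> aB; rewrite /square_summable -l2_series.
apply: nondecreasing_is_cvgn; first exact: l2_homo.
by exists B => _ [M _ <-].
Qed.

Lemma H2_eq f g : hcoef f = hcoef g -> f = g.
Proof.
move=> fg; apply: val_inj; apply/funext => z /=.
have [z1|z1] := pselect (disc z).
  move/discE : z1 => z1; have := evals_hcoef f z1; rewrite fg => H.
  exact: tends_unique H (evals_hcoef g z1).
have out (h : H2 R) : h z = 0.
  by have := hardy_funP h; rewrite inE => -[_ H]; apply: H.
by rewrite !out.
Qed.

Lemma power_series_converges a B z : (forall n, normc (a n) <= B) ->
  normc z < 1 -> exists l, tends (psum a z) l.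
Proof.
move=> aB z1; set r := normc z; have r0 : 0 <= r := normc_ge0 z.
have B0 : 0 <= B := le_trans (normc_ge0 _) (aB 0%N).
have wB N : wnorm r N a <= B * (1 - r)^-1.
  apply: le_trans (ler_wpM2l B0 (geometric_bound N r0 z1)).
  rewrite mulr_sumr; apply: ler_sum => n _.
  by rewrite ler_wpM2r ?exprn_ge0.
have [U [U_ultra leU]] := ultraFilterLemma eventually_filter.
have Uf : ProperFilter U by exact: ultra_proper.
have [l Hl] := complex_ultralimit U_ultra
  (fun N => le_trans (wnorm_psum a z N) (wB N)).
exists l => e e0; have e3 : 0 < e / 3 by rewrite divr_gt0.
have [N HN] := nondecreasing_tail (wnorm_homo a r0) wB e3.
have close n : (N <= n)%N -> normc (psum a z n - psum a z N) < e / 3.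
  move=> Nn; apply: le_lt_trans (HN n Nn).
  have [k ->] : exists k, n = (N + k)%N by exists (n - N)%N; rewrite subnKC.
  rewrite /psum /wnorm !big_split_ord /= addrAC subrr add0r addrAC subrr add0r.
  apply: le_trans (ler_normc_sum _ _ _) _.
  by apply: ler_sum => i _; rewrite normcM normcX.
have Uev : U [set n | (N <= n)%N] by apply: leU; exists N.
have [m [/= ml Nm]] := filter_ex (filterI (Hl _ e3) Uev).
exists N => n Nn; have := close n Nn; have := close m Nm.
rewrite [normc (psum a z m - _)]normc_distC.
have := ler_normc_dist (psum a z n) (psum a z N) (psum a z m).
have := ler_normc_dist (psum a z n) (psum a z m) l.
by lra.
Qed.

(** With [H2_eq], this identifies the Hardy space with the square-summable
    sequences. *)
Lemma H2_of_coef a : square_summable a -> exists f, hcoef f = a.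
Proof.
move=> sa.
have l2a M : l2 M a <= limn (fun M => l2 M a).
  apply: (nondecreasing_cvgn_le (l2_homo a)).
  by rewrite l2_series.
set L := limn _ in l2a.
have aB n : normc (a n) <= L + 1.
  have L0 : 0 <= L := le_trans (l2_ge0 0 a) (l2a 0%N).
  have := le_trans (l2_coef a n) (l2a n.+1).
  by have := normc_ge0 (a n); move: (normc (a n)) => x x0; nra.
have conv z : exists l, normc z < 1 -> tends (psum a z) l.
  have [z1|z1] := ltP (normc z) 1; last by exists 0.
  by have [l Hl] := power_series_converges aB z1; exists l.
have [G HG] : exists G : C -> C, forall z, normc z < 1 -> tends (psum a z) (G z).
  by exists (fun z => projT1 (cid (conv z))) => z; case: cid.
pose F z : C := if normc z < 1 then G z else 0.
have aF : evals a F.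
  by move=> z z1; rewrite /F z1; exact: HG.
have Fin : F \in @hardy_pred R.
  rewrite inE; split; first by exists a; split=> //; exact/evals_taylor.
  move=> z nz; rewrite /F; case: ifP => // z1.
  by case: nz; apply/discE.
exists (HardyFun Fin); exact: (@evals_unique _ _ _ F (evals_hcoef (HardyFun Fin)) aF).
Qed.

Lemma hcoef_linear (c : C) f g : hcoef (c *: f + g) = fC c * hcoef f + hcoef g.
Proof.
apply: (evals_unique (evals_hcoef _)) => z z1.
exact: (evalsD (evalsM (evalsC c) (evals_hcoef f)) (evals_hcoef g) z1).
Qed.

Lemma hcoef0 : hcoef 0 = 0.
Proof.
have := hcoef_linear (-1) 0 0; rewrite scaler0 addr0 => ->.
by rewrite rmorphN rmorph1 mulN1r addNr.
Qed.

Lemma inner_finite f g N : (forall n, (N <= n)%N -> hcoef g n = 0) ->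
  H2_inner f g = \sum_(n < N) hcoef f n * conjc (hcoef g n).
Proof.
move=> gN; rewrite /H2_inner; apply: cvg_lim; first exact: norm_hausdorff.
apply/tendsP => e e0; exists N => n Nn.
rewrite /series /= big_mkord.
have [k ->] : exists k, n = (N + k)%N by exists (n - N)%N; rewrite subnKC.
rewrite big_split_ord /= addrAC subrr add0r big1 ?normc0 // => i _.
have := gN (N + i)%N (leq_addr _ _); rewrite /hcoef /= => ->.
by rewrite conjc0 mulr0.
Qed.

Lemma ip_norm_sqr f :
  ip_norm (@H2_inner R) f = Num.sqrt (limn (fun M => l2 M (hcoef f))).
Proof.
rewrite /ip_norm; congr Num.sqrt.
have cl : (fun M => l2 M (hcoef f)) @ \oo --> limn (fun M => l2 M (hcoef f)).
  by have := @summable_hcoef f; rewrite /square_summable -l2_series.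
set L := limn _ in cl *.
suff -> : H2_inner f f = L%:C by [].
apply: cvg_lim; first exact: norm_hausdorff.
apply/tendsP => e e0; move/cvgrPdist_lt : cl => /(_ e e0) [N _ HN].
exists N => n Nn; have := HN n Nn; rewrite /= distrC -normc_real rmorphB /=.
suff -> : series (fun n => taylor_coef f n * conjc (taylor_coef f n)) n =
  (l2 n (hcoef f))%:C by [].
rewrite /l2 rmorph_sum /series /= big_mkord.
by apply: eq_bigr => i _; rewrite normc_sqr.
Qed.

Lemma l2_ip_norm f M : l2 M (hcoef f) <= ip_norm (@H2_inner R) f ^+ 2.
Proof.
have cl : cvgn (fun M => l2 M (hcoef f)).
  by have := @summable_hcoef f; rewrite /square_summable -l2_series.
have le M' := nondecreasing_cvgn_le (l2_homo (hcoef f)) cl M'.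
rewrite ip_norm_sqr sqr_sqrtr //.
exact: le_trans (l2_ge0 0 _) (le 0%N).
Qed.

Lemma ip_norm_le f B : 0 <= B -> (forall M, l2 M (hcoef f) <= B ^+ 2) ->
  ip_norm (@H2_inner R) f <= B.
Proof.
move=> B0 fB; rewrite ip_norm_sqr -[leRHS](ger0_norm B0) -sqrtr_sqr ler_wsqrtr //.
apply: limr_le; last by near=> n; exact: fB.
by have := @summable_hcoef f; rewrite /square_summable -l2_series.
Unshelve. all: by end_near. Qed.

Lemma ip_norm_ge0 f : 0 <= ip_norm (@H2_inner R) f.
Proof. exact: sqrtr_ge0. Qed.

(** Operators are constructed on coefficient sequences.  The bound is asked for
    strict upper bounds [B] of the norm, to avoid a case distinction for 0. *)
Lemma bounded_operator_of_coef (L : fps C -> fps C) (D : R) :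
  (forall a b, L (a + b) = L a + L b) ->
  (forall c a, L (fC c * a) = fC c * L a) ->
  (forall a B, 0 < B -> (forall M, l2 M a <= B ^+ 2) ->
     forall M, l2 M (L a) <= (B * D) ^+ 2) -> 0 <= D ->
  exists T : bounded_operator (@H2_inner R), forall f, hcoef (T f) = L (hcoef f).
Proof.
move=> LD LZ LB D0.
have bnd f B : ip_norm (@H2_inner R) f < B ->
    forall M, l2 M (L (hcoef f)) <= (B * D) ^+ 2.
  move=> fB; have B0 : 0 < B := le_lt_trans (ip_norm_ge0 f) fB.
  apply: LB => // M; apply: le_trans (l2_ip_norm f M) _.
  by rewrite ler_pXn2r ?nnegrE ?ip_norm_ge0 ?(ltW B0) ?(ltW fB).
have ex f : exists g, hcoef g = L (hcoef f).
  apply: H2_of_coef; pose B := ip_norm (@H2_inner R) f + 1.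
  apply: (@summable_l2 _ ((B * D) ^+ 2)); apply: bnd.
  by rewrite ltrDl ltr01.
have [T TE] : exists T, forall f, hcoef (T f) = L (hcoef f).
  by exists (fun f => projT1 (cid (ex f))) => f; case: cid.
have T_linear : linear T.
  move=> c f g; apply: H2_eq.
  by rewrite TE (hcoef_linear c f g) (hcoef_linear c (T f) (T g)) LD LZ !TE.
pose T' : {linear H2 R -> H2 R} :=
  HB.pack T (GRing.isLinear.Build _ _ _ _ T T_linear).
have T'_bounded : exists M : R, forall f,
    ip_norm (@H2_inner R) (T' f) <= M * ip_norm (@H2_inner R) f.
  exists D => f; apply/ler_addgt0Pr => e e0.
  have D1 : 0 < D + 1 by rewrite ltr_wpDl.
  pose B := ip_norm (@H2_inner R) f + e / (D + 1).
  have fB : ip_norm (@H2_inner R) f < B by rewrite ltrDl divr_gt0.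
  have B0 : 0 <= B * D.
    by rewrite mulr_ge0 // (le_trans (ip_norm_ge0 f)) // ltW.
  apply: (@le_trans _ _ (B * D)).
    by apply: ip_norm_le => // M; rewrite TE; exact: bnd.
  rewrite /B mulrDl mulrC lerD2l mulrAC ler_pdivrMr //.
  by rewrite ler_pM2l // lerDl.
by exists (BoundedOperator T'_bounded).
Qed.

End HardyOperators.

(** * The composition operator has no minimal commutant *)

Lemma eq_evals (R : realType) (a : fps R[i]) (f g : R[i] -> R[i]) :
  (forall z, normc z < 1 -> f z = g z) -> evals a f -> evals a g.
Proof. by move=> fg af z z1; rewrite -fg //; exact: af. Qed.

Lemma hcoef_sum (R : realType) N (c : nat -> R[i]) (F : nat -> H2 R) :
  hcoef (\sum_(k < N) c k *: F k) = \sum_(k < N) fC (c k) * hcoef (F k).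
Proof.
elim: N => [|N IH]; first by rewrite !big_ord0 hcoef0.
by rewrite !big_ord_recr /= [X in hcoef X]addrC hcoef_linear IH addrC.
Qed.

Theorem corollary8p5 (R : realType) (phi psi : R[i] -> R[i]) (lambda : R[i])
    (p : nat)
    (phi_disc : forall z, disc z -> disc (phi z))
    (phi_hol : holomorphic_on_disc phi)
    (p_ge2 : (2 <= p)%N)
    (lambda_neq0 : lambda != 0)
    (psi_hol : holomorphic_on_disc psi)
    (psi0 : psi 0 = 1)
    (psi_neq0 : forall z, disc z -> psi z != 0)
    (phiE : forall z, disc z -> phi z = lambda * z ^+ p * psi z)
    (phi_iter : exists n : nat, (1 <= n)%N /\ supnorm (iter n phi) < 1) :
  exists C_phi : bounded_operator (@H2_inner R),
    is_composition_operator phi C_phi /\ ~ has_minimal_commutant C_phi.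
Proof.
have p_gt0 : (0 < p)%N by exact: ltnW.
have phi_lt1 z : normc z < 1 -> normc (phi z) < 1.
  by move=> /discE/phi_disc/discE.
have phi_le1 z : normc z < 1 -> normc (phi z) <= 1.
  by move=> /phi_lt1/ltW.
have [n0 [_ s1]] := phi_iter; move: s1; set s := supnorm _ => s1.
have iter_le z : normc z < 1 -> normc (iter n0 phi z) <= s.
  move=> z1; apply: ub_le_sup; last by exists z => //; exact/discE.
  exists 1 => _ [w /discE w1 <-].
  suff : normc (iter n0 phi w) < 1 by move/ltW.
  by elim: (n0) => //= k; exact: phi_lt1.
have [c cpsi] : exists c : fps R[i], evals c psi.
  apply: holomorphic_power_series => [z /discE/psi_hol //|r r0 r1].
  have l0 : 0 < normc lambda by rewrite normc_gt0.
  exists (normc lambda * r ^+ p)^-1 => z zr.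
  have z1 : normc z < 1 by rewrite zr.
  rewrite -[leRHS]mul1r ler_pdivlMr ?mulr_gt0 ?exprn_gt0 // mulrC.
  rewrite -zr -normcX -!normcM -phiE; first exact: phi_le1.
  exact/discE.
have c0 : c 0%N = 1.
  have z1 : normc (0 : R[i]) < 1 by rewrite normc0 ltr01.
  rewrite -psi0; apply: (tends_unique _ (cpsi 0 z1)).
  move=> e e0; exists 1%N => -[//|n] _.
  rewrite /psum big_ord_recl big1 => [|i _]; last by rewrite lift0 exprS mul0r mulr0.
  by rewrite expr0 mulr1 addr0 subrr normc0.
pose F : fps R[i] := fX ^+ p * (fC lambda * c).
have Fphi : evals F phi.
  apply: (@eq_evals _ _ (fun z => ('X^p).[z] * (lambda * psi z))).
    by move=> z /discE z1; rewrite hornerXn phiE // mulrA [z ^+ p * _]mulrC.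
  rewrite /F fXnE; apply: evalsM; first exact: evals_poly.
  by apply: evalsM => //; exact: evalsC.
have F_vanish : vanish p F by apply/vanishP; exists (fC lambda * c).
have F0 : F 0%N = 0 by exact: F_vanish.
have F_inv := phi_inv lambda_neq0 c0 (erefl F).
pose v := inv_phi c lambda; rewrite -/v in F_inv.
have [A AE] : exists A : bounded_operator (@H2_inner R),
    forall f, hcoef (A f) = fcomp F (hcoef f).
  apply: (@bounded_operator_of_coef _ _ 1) => //.
  - by move=> a b; rewrite fcompD.
  - by move=> d a; rewrite (fcompM F0) fcompC.
  move=> a B B0 aB M; rewrite mulr1.
  exact: le_trans (littlewood Fphi phi_le1 M a F0) (aB M).
exists A; split.
  move=> f z /discE z1; apply: (tends_unique (evals_hcoef (A f) z1)).
  rewrite AE; apply: (evals_fcomp Fphi phi_le1 phi_lt1 F0 _ (evals_hcoef f) z1).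
  exact: l2_ip_norm.
have [m [D [m0 m_pow D0 bound]]] :=
  twist_bounded Fphi phi_lt1 p_ge2 lambda_neq0 c0 (erefl F) s1 iter_le.
have [T TE] : exists T : bounded_operator (@H2_inner R),
    forall f, hcoef (T f) = twist F v p m (hcoef f).
  apply: (@bounded_operator_of_coef _ _ D) => //; last exact: ltW.
  - by move=> a b; rewrite twistD.
  - by move=> d a; rewrite twistZ.
have [g [gm g0]] := annihilator p_ge2 F_vanish F_inv m_pow.
have [G GE] : exists G : H2 R, hcoef G =
    FPS (fun n => if (n < m.+1)%N then conjc (g n) else 0).
  set b := FPS _; apply: H2_of_coef; apply: (@summable_l2 _ _ (l2 m.+1 b)) => M.
  apply: le_trans (l2_homo b (leq_addl m.+1 M)) _ => /=.
  rewrite /l2 big_split_ord /= [X in _ + X]big1 ?addr0 // => i _.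
  rewrite [X in normc X](_ : _ = 0) ?normc0 ?expr0n //.
  by rewrite ltnNge leq_addr.
have [Z ZE] : exists Z : H2 R, hcoef Z = fX.
  apply: H2_of_coef; apply: (@summable_l2 _ _ 1) => M.
  exact: (l2_phi_iter Fphi phi_lt1 p_ge2 (erefl F) 0 M).
have inner f : H2_inner f G = \sum_(n < m.+1) hcoef f n * g n.
  rewrite (@inner_finite _ f G m.+1) => [|n mn]; last first.
    by rewrite GE /= ltnNge mn.
  by apply: eq_bigr => n _; rewrite GE /= ltn_ord conjcK.
move=> minimal.
have T_comm : commutant A T.
  by move=> f; apply: H2_eq; rewrite TE !AE TE twist_fcomp.
have : H2_inner (T Z) G = 0.
  apply: (@closure_matrix_coefficient0 _ _ _ (alg A)); last by rewrite minimal.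
  move=> S [q SE]; rewrite SE inner.
  have iterE k : hcoef (iter k A Z) = iter k (fcomp F) fX.
    by elim: k => [|k IH] //=; rewrite AE IH.
  rewrite (hcoef_sum (size q) (fun k => q`_k) (fun k => iter k A Z)).
  under eq_bigr do rewrite fps_sumE mulr_suml.
  rewrite exchange_big big1 // => k _.
  under eq_bigr => n _ do rewrite iterE fCME -mulrA [_ * g n]mulrC.
  by rewrite -mulr_sumr g0 mulr0.
rewrite inner; under eq_bigr => n _.
  rewrite TE ZE (twistX _ p_ge2 F_vanish m0); last by rewrite -ltnS.
  over.
rewrite big_ord_recr /= eqxx gm mulr1 big1 ?add0r => [/eqP|n _].
  by rewrite oner_eq0.
by rewrite ltn_eqF ?mul0r.
Qed.
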